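(* Let $q\ge1$ be an integer. Any graph $G=(V,E,\ell)$ of treewidth at most $p$ with a set $T\subset V$ of $k\ge p$ terminals admits a $(2q-1,\ \mathcal{O}(p^{1+2/q}k))$-DAM, where the constant hidden in $\mathcal{O}(\cdot)$ is absolute (independent of $G$, $T$, $k$, $p$ and $q$).
   Context: Here $p\ge1$ is an integer. Graphs $G=(V,E,\ell)$ are finite and undirected, with an edge length function $\ell:E\to\mathbb{R}^+$ and a designated set $T\subset V$ of $k$ vertices called terminals; the other vertices are non-terminals. $d_G$ is the shortest-path distance. A minor of $G$ is a graph obtained by a sequence of vertex deletions, edge deletions and edge contractions, where no terminal may be deleted and no two terminals may be contracted together (so every terminal survives; a super-node containing terminal $t$ is identified with $t$); a minor carries its own edge length function $\ell'$. A minor $H=(V',E',\ell')$ of $G$ is an $\alpha$-distance approximating minor ($\alpha$-DAM) of $G$ if $d_G(t,t')\le d_H(t,t')\le\alpha\cdot d_G(t,t')$ for all $t,t'\in T$. It is an $(\alpha,y)$-DAM if in addition it has at most $y$ non-terminals. *)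

(* Defs.v *)
From HB Require Import structures.
From mathcomp Require Import all_boot all_order all_algebra.
From mathcomp Require boolp.
From mathcomp Require Import classical_sets reals constructive_ereal ereal exp.
(* Imported last: unqualified set names (setT, set0, imsetP, ...) are those of finset. *)
From mathcomp Require Import boot.finset.

Set Implicit Arguments.
Unset Strict Implicit.
Unset Printing Implicit Defensive.

Import Order.TTheory GRing.Theory Num.Theory.

(* Finite simple undirected graphs. The vertex set is a subset of a finite
   ambient type, so that the vertices of a minor have the same type as those of
   the original graph; edges are two-element sets of vertices. *)
Record graph (V : finType) := Graph {
  vset : {set V};
  eset : {set {set V}};
  esetP : forall e, e \in eset -> (e \subset vset) && (#|e| == 2)
}.

Definition adj (V : finType) (G : graph V) : rel V :=
  fun x y => [set x; y]%SET \in eset G.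

Definition connected (V : finType) (G : graph V) : Prop :=
  (exists x, x \in vset G) /\
  (forall x y, x \in vset G -> y \in vset G -> connect (adj G) x y).

Definition acyclic (V : finType) (G : graph V) : Prop :=
  forall c : seq V, 2 < size c -> ~ ucycle (adj G) c.

Definition is_tree (V : finType) (G : graph V) : Prop :=
  connected G /\ acyclic G.

Lemma induced_subproof (V : finType) (G : graph V) (S : {set V}) e :
  e \in [set e in eset G | e \subset S]%SET ->
  (e \subset vset G :&: S) && (#|e| == 2).
Proof. by rewrite inE subsetI => /andP[/esetP/andP[-> ->] ->]. Qed.

Definition induced (V : finType) (G : graph V) (S : {set V}) : graph V :=
  Graph (@induced_subproof V G S).

Record tree_decomposition (V : finType) (G : graph V)
    (I : finType) (F : graph I) (B : I -> {set V}) : Prop := {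
  td_tree : is_tree F;
  td_vset : (\bigcup_(i in vset F) B i)%SET = vset G;
  td_eset : forall e, e \in eset G -> exists2 i, i \in vset F & e \subset B i;
  td_conn : forall v, v \in vset G ->
    connected (induced F [set i | v \in B i]%SET)
}.

Definition td_width (V I : finType) (F : graph I) (B : I -> {set V}) : nat :=
  (\max_(i in vset F) #|B i|).-1.

Definition has_td_of_width (V : finType) (G : graph V) (w : nat) : Prop :=
  exists (I : finType) (F : graph I) (B : I -> {set V}),
    tree_decomposition G F B /\ td_width F B = w.

Lemma unit_tree_subproof (e : {set unit}) :
  e \in (set0 : {set {set unit}}) -> (e \subset setT) && (#|e| == 2).
Proof. by rewrite inE. Qed.

Lemma has_td_ex (V : finType) (G : graph V) :
  exists w, boolp.asbool (has_td_of_width G w).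
Proof.
pose F := Graph unit_tree_subproof; pose B (_ : unit) := vset G.
exists (td_width F B); apply/boolp.asboolP; exists unit, F, B; split=> //; split.
- split; first by split; [exists tt; rewrite inE | case; case].
  by case=> [|[] [|[] c]] //= _; rewrite /ucycle /=; case/andP=> _.
- apply/setP => x; apply/bigcupP/idP => [[] //|Gx].
  by exists tt; rewrite ?inE.
- by move=> e /esetP/andP[eG _]; exists tt; rewrite ?inE.
- move=> v Gv; split; first by exists tt; rewrite !inE.
  by case; case.
Qed.

(* The width of a decomposition is a truncated difference, so the treewidth of
   the graph with no vertex is 0 here rather than -1. *)
Definition treewidth (V : finType) (G : graph V) : nat := ex_minn (has_td_ex G).

Lemma del_vertex_subproof (V : finType) (G : graph V) (v : V) e :
  e \in [set e in eset G | v \notin e]%SET ->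
  (e \subset vset G :\ v) && (#|e| == 2).
Proof. by rewrite inE subsetD1 => /andP[/esetP/andP[-> ->] ->]. Qed.

Definition del_vertex (V : finType) (G : graph V) (v : V) : graph V :=
  Graph (@del_vertex_subproof V G v).

Lemma del_edge_subproof (V : finType) (G : graph V) (f e : {set V}) :
  e \in (eset G :\ f)%SET -> (e \subset vset G) && (#|e| == 2).
Proof. by rewrite !inE => /andP[_ /esetP]. Qed.

Definition del_edge (V : finType) (G : graph V) (f : {set V}) : graph V :=
  Graph (@del_edge_subproof V G f).

Definition merge (V : finType) (u v x : V) : V := if x == v then u else x.

Lemma contract_subproof (V : finType) (G : graph V) (u v : V) f :
  f \in [set f in [set merge u v @: (e : {set V}) | e in eset G] | #|f| == 2]%SET ->
  (f \subset merge u v @: vset G) && (#|f| == 2).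
Proof.
rewrite inE => /andP[/imsetP[e /esetP/andP[eG _] ->] ->]; rewrite andbT.
exact: imsetS.
Qed.

(* Contraction of the edge uv; the super-node is called u. The image of the
   edge uv itself is a singleton, which is discarded. *)
Definition contract (V : finType) (G : graph V) (u v : V) : graph V :=
  Graph (@contract_subproof V G u v).

(* Minors of G with respect to the terminal set T. In [minor_contract] the
   vertex v that loses its name is not a terminal: two terminals are never
   contracted together, and a super-node containing a terminal keeps the name
   of that terminal (for v a terminal and u not, contract with u and v
   exchanged). *)
Inductive minor (V : finType) (T : {set V}) (G : graph V) : graph V -> Prop :=
| minor_refl : minor T G G
| minor_del_vertex (H : graph V) (v : V) :
    minor T G H -> v \in vset H -> v \notin T -> minor T G (del_vertex H v)
| minor_del_edge (H : graph V) (e : {set V}) :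
    minor T G H -> e \in eset H -> minor T G (del_edge H e)
| minor_contract (H : graph V) (u v : V) :
    minor T G H -> [set u; v]%SET \in eset H -> v \notin T ->
    minor T G (contract H u v).

Local Open Scope ring_scope.

(* Only the values of [len] on edges matter. *)
Record wgraph (R : realType) (V : finType) := WGraph {
  wg :> graph V;
  len : {set V} -> R;
  len_gt0 : forall e, e \in eset wg -> 0 < len e
}.

Definition path_length (R : realType) (V : finType) (G : wgraph R V)
    (x : V) (s : seq V) : R :=
  \sum_(e <- pairmap (fun a b => [set a; b]%SET) x s) len G e.

Definition is_path (V : finType) (G : graph V) (x y : V) (s : seq V) : Prop :=
  [/\ path (adj G) x s, uniq (x :: s) & last x s = y].

(* The distance is +oo between vertices in different components. *)
Definition dist (R : realType) (V : finType) (G : wgraph R V) (x y : V)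
    : \bar R :=
  ereal_inf [set (path_length G x s)%:E | s in [set s | is_path G x y s]]%classic.

Definition is_DAM (R : realType) (V : finType) (T : {set V}) (G : wgraph R V)
    (alpha : R) (H : wgraph R V) : Prop :=
  minor T G H /\
  forall t t', t \in T -> t' \in T ->
    (dist G t t' <= dist H t t')%E /\
    (dist H t t' <= alpha%:E * dist G t t')%E.

Definition is_DAM_size (R : realType) (V : finType) (T : {set V})
    (G : wgraph R V) (alpha y : R) (H : wgraph R V) : Prop :=
  is_DAM T G alpha H /\ #|(vset H :\: T)%SET|%:R <= y.

(* Main.v *)
Require Import Defs.
From HB Require Import structures.
From mathcomp Require Import all_boot all_order all_algebra.
From mathcomp Require Import zify ring lra.
From mathcomp Require boolp ereal.
From mathcomp Require Import constructive_ereal.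
From mathcomp Require Import reals exp.

(* Absorbing the bags of a tree decomposition one by one, and cutting off a piece
   whenever enough terminals have been collected, covers the edges of G by
   O(k / p) pieces that overlap only in a set S of O(k) vertices containing T,
   each of them meeting S in O(p) vertices. In a piece, take a greedy
   (2q-1)-spanner of the metric on its n vertices of S; it has no cycle of length
   at most 2q, hence at most n^(1+1/q) edges. Realise its edges by shortest paths
   that are unique after a tie-breaking perturbation of the lengths: two such
   paths meet in a common subpath, so that their union has O(n^(2+2/q)) vertices
   of degree at least 3. The union of all these paths approximates the distances
   between vertices of S, and suppressing its vertices of degree at most 2
   outside S preserves them. *)

Set Implicit Arguments.
Unset Strict Implicit.
Unset Printing Implicit Defensive.

Import Order.TTheory GRing.Theory Num.Theory.
Local Open Scope ring_scope.

(** * Walks with respect to a set of edges *)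

Section Walks.
Variables (R : realFieldType) (V : finType).
Implicit Types (x y z : V) (s t : seq V) (e : {set V}).
Implicit Types (E F S : {set {set V}}) (l w : {set V} -> R).

(** A realised spanner on all of [T] at once would cost about [k ^ (2 + 2 / q)] vertices. The bags
    keep the trace of [S] on a piece down to [O(p)] vertices, so a piece costs [O(p ^ (2 + 2 / q))],
    and [O(k / p)] pieces give the bound. Treating pieces separately does not hurt the stretch: they
    overlap only in [S], so a walk of [G] between vertices of [S] splits at its visits to [S] into
    walks that each stay in one piece. This is why distances are approximated between all vertices
    of [S] and not only between terminals. The perturbed lengths only select paths; every cost is
    measured in the original lengths, which the selected paths minimise as well. Distances never
    drop, because each edge of the minor is as long as some walk of [G] between its ends. *)

Definition edges x s : seq {set V} := pairmap (fun a b => [set a; b]) x s.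

Definition walk E x y s := (last x s == y) && all (mem E) (edges x s).

Definition cost l x s : R := \sum_(e <- edges x s) l e.

Definition nbhd E x : {set V} := [set y | [set x; y] \in E].

Lemma edges_cat x s t : edges x (s ++ t) = edges x s ++ edges (last x s) t.
Proof. exact: pairmap_cat. Qed.

Lemma cost_cat l x s t : cost l x (s ++ t) = cost l x s + cost l (last x s) t.
Proof. by rewrite /cost edges_cat big_cat. Qed.

Lemma walkE E x y s : walk E x y s = (last x s == y) && all (mem E) (edges x s).
Proof. by []. Qed.

Lemma walk_edge E x y s e : walk E x y s -> e \in edges x s -> e \in E.
Proof. by case/andP=> _ /allP Es /Es. Qed.

Lemma walk_last E x y s : walk E x y s -> last x s = y.
Proof. by case/andP=> /eqP. Qed.

Lemma walk_nil E x : walk E x x [::].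
Proof. by rewrite walkE eqxx. Qed.

Lemma walk_cat E x y z s t :
  walk E x y s -> walk E y z t -> walk E x z (s ++ t).
Proof.
case/andP=> /eqP <- Es /andP[/eqP <- Et].
by rewrite walkE last_cat eqxx edges_cat all_cat Es Et.
Qed.

Lemma walk_catP E x y s t : walk E x y (s ++ t) ->
  walk E x (last x s) s /\ walk E (last x s) y t.
Proof.
by rewrite !walkE last_cat edges_cat all_cat eqxx => /andP[-> /andP[-> ->]].
Qed.

Lemma walk_cons E x y z s :
  walk E x y (z :: s) = ([set x; z] \in E) && walk E z y s.
Proof. by rewrite !walkE /= andbCA. Qed.

Lemma cost_cons l x z s : cost l x (z :: s) = l [set x; z] + cost l z s.
Proof. by rewrite /cost /= big_cons. Qed.

Lemma cost_nil l x : cost l x [::] = 0.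
Proof. by rewrite /cost big_nil. Qed.

Lemma walk_sub E F x y s : {subset edges x s <= F} -> walk E x y s ->
  walk F x y s.
Proof. by move=> sF /andP[e _]; rewrite walkE e; apply/allP. Qed.

Lemma walk_subset E F x y s : E \subset F -> walk E x y s -> walk F x y s.
Proof.
move=> /subsetP sEF ws; have /andP[_ /allP sE] := ws.
by apply: walk_sub ws => e /sE /sEF.
Qed.

Lemma walk_path E x y s :
  walk E x y s = (last x s == y) && path (fun a b => [set a; b] \in E) x s.
Proof.
rewrite walkE; congr (_ && _).
by elim: s x => //= z s IH x; rewrite IH.
Qed.

Lemma edges_subset x s e : e \in edges x s -> {subset e <= x :: s}.
Proof.
elim: s x => //= z s IH x; rewrite inE => /orP[/eqP->|/IH es] y.
  by rewrite !inE => /orP[]/eqP->; rewrite eqxx ?orbT.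
by move/es; rewrite !inE => ->; rewrite orbT.
Qed.

Lemma uniq_edges x s : uniq (x :: s) -> uniq (edges x s).
Proof.
elim: s x => //= z s IH x /andP[xs /IH->]; rewrite andbT.
apply: contra xs => /edges_subset; apply.
by rewrite !inE eqxx.
Qed.

Lemma simple_walk E x y s : walk E x y s -> exists2 s',
  walk E x y s' & uniq (x :: s') /\ {subset edges x s' <= edges x s}.
Proof.
rewrite {1}walkE => /andP[/eqP xy /allP sE].
(* The walk is shortened as a path along its own edges, so that the result uses no other edge. *)
have: path (fun a b => [set a; b] \in edges x s) x s.
  suff: walk [set e in edges x s] x y s.
    rewrite walk_path xy eqxx /= => p; apply: sub_path p => a b /=.
    by rewrite inE.
  by rewrite walkE xy eqxx; apply/allP => e; rewrite /= inE.
move: xy => /[swap] /shortenP[s' ps' us' _] xy.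
have sub : walk [set e in edges x s] x y s'.
  rewrite walk_path xy eqxx; apply: sub_path ps' => a b /=.
  by rewrite inE.
have sub' : {subset edges x s' <= edges x s}.
  by move=> e es'; case/andP: sub => _ /allP/(_ e es') /=; rewrite inE.
exists s' => //; rewrite walkE xy eqxx; apply/allP => e /sub'; exact: sE.
Qed.

Lemma big_edges l x s : uniq (x :: s) ->
  cost l x s = \sum_(e in [set e in edges x s]) l e.
Proof.
move=> /uniq_edges us; rewrite /cost big_uniq //=.
by apply: eq_bigl => e; rewrite inE.
Qed.

Lemma le_cost l x s x' s' : (forall e, e \in edges x' s' -> 0 <= l e) ->
  uniq (x :: s) -> {subset edges x s <= edges x' s'} ->
  cost l x s <= cost l x' s'.
Proof.
rewrite /cost => + /uniq_edges.
elim: (edges x s) (edges x' s') => {x s x' s'} [|e r IH] r' l0 /=.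
  by move=> _ _; rewrite big_nil big_seq sumr_ge0.
move=> /andP[er ur] sub; have er' : e \in r' by apply: sub; rewrite inE eqxx.
rewrite big_cons (perm_big _ (perm_to_rem er')) big_cons lerD2l.
apply: IH => // [e' /mem_rem/l0 //|e' re'].
have := sub e'; rewrite inE re' orbT => /(_ isT).
rewrite (perm_mem (perm_to_rem er')) inE => /predU1P[e'e|//].
by rewrite -e'e re' in er.
Qed.

Lemma rev_edges x s : exists2 s', last (last x s) s' = x &
  edges (last x s) s' = rev (edges x s) /\ rev (x :: s) = last x s :: s'.
Proof.
elim/last_ind: s => [|s z [s' ls' [es' rs']]]; first by exists [::].
exists (last x s :: s'); rewrite last_rcons //=.
rewrite -cats1 edges_cat rev_cat -es' /= setUC; split=> //.
by rewrite -cat_cons cats1 rev_rcons rs'.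
Qed.

Lemma rev_walk E x y s : walk E x y s -> exists2 s', walk E y x s' &
  edges y s' = rev (edges x s) /\ (uniq (x :: s) -> uniq (y :: s')).
Proof.
rewrite walkE => /andP[/eqP<- Es]; have [s' ls' [es' rs']] := rev_edges x s.
exists s'; first by rewrite walkE ls' eqxx es' all_rev.
by rewrite -rs' rev_uniq.
Qed.

Lemma cost_rev l x y s s' : edges y s' = rev (edges x s) ->
  cost l y s' = cost l x s.
Proof. by rewrite /cost => ->; rewrite (perm_big (edges x s)) ?perm_rev. Qed.

(** Edges are replaced by walks one at a time. This serves both to realise spanner edges by paths
    and to undo a contraction. *)
Lemma walk_expand (c : R) E F l l' x y s :
  (forall a b, [set a; b] \in edges x s -> exists2 t, walk F a b t &
     cost l' a t <= c * l [set a; b]) ->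
  walk E x y s -> exists2 t, walk F x y t & cost l' x t <= c * cost l x s.
Proof.
elim: s x => [|z s IH] x exp.
  move=> /andP[/eqP<- _]; exists [::]; first exact: walk_nil.
  by rewrite !cost_nil mulr0.
rewrite walk_cons => /andP[_ /IH[a b abs|t wt ct]].
  by apply: exp; rewrite inE abs orbT.
have [t' wt' ct'] := exp x z (mem_head _ _); exists (t' ++ t).
  exact: walk_cat wt' wt.
have /andP[/eqP lt' _] := wt'.
by rewrite cost_cat lt' cost_cons mulrDr lerD.
Qed.

End Walks.

(** * Perturbing weights so that subset sums become distinct *)

Lemma binary_inj n (a b : nat -> bool) :
  (\sum_(i < n) a i * 2 ^ i = \sum_(i < n) b i * 2 ^ i)%N ->
  forall i, (i < n)%N -> a i = b i.
Proof.
elim: n a b => // n IH a b.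
have shift (c : nat -> bool) : (\sum_(i < n.+1) c i * 2 ^ i =
    c 0 + (\sum_(i < n) c i.+1 * 2 ^ i).*2)%N.
  rewrite big_ord_recl expn0 muln1 -muln2 big_distrl; congr (_ + _)%N.
  by apply: eq_bigr => i _; rewrite lift0 expnSr mulnA.
rewrite !shift => eq; have eq0 : a 0%N = b 0%N.
  by have := congr1 odd eq; rewrite !oddD !odd_double !addbF !oddb.
case=> // i; apply: (IH (fun i => a i.+1) (fun i => b i.+1)).
by move: eq; rewrite eq0 => /addnI /double_inj.
Qed.

(** The sum is the number whose binary digits form the indicator function of [A]. *)
Lemma set_code_inj (I : finType) :
  injective (fun A : {set I} => \sum_(i in A) 2 ^ enum_rank i)%N.
Proof.
move=> A B /= eqAB; apply/setP => i.
pose bit (C : {set I}) (k : nat) : bool :=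
  if insub k is Some k' then enum_val (k' : 'I_#|I|) \in C else false.
have bitE C (j : I) : bit C (enum_rank j) = (j \in C).
  by rewrite /bit valK enum_rankK.
have code (C : {set I}) :
    (\sum_(i in C) 2 ^ enum_rank i = \sum_(k < #|I|) bit C k * 2 ^ k)%N.
  rewrite (reindex_onto (@enum_rank I) enum_val) /=; last first.
    by move=> j _; rewrite enum_valK.
  rewrite big_mkcond /=; apply: eq_big => [j|j _]; first by rewrite enum_rankK eqxx.
  by rewrite bitE; case: (j \in C); rewrite ?mul1n ?mul0n.
move: eqAB; rewrite !code => eqAB.
by have := binary_inj eqAB (ltn_ord (enum_rank i)); rewrite !bitE.
Qed.

(** Meant for the list of differences of subset sums: a perturbation smaller than [d] cannot reverse
    a strict inequality between two such sums. *)
Lemma gap (R : realFieldType) (r : seq R) :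
  exists2 d : R, 0 < d & forall x, x \in r -> 0 < x -> d <= x.
Proof.
elim: r => [|y r [d d0 IH]]; first by exists 1.
exists (if 0 < y then Order.min d y else d); first by case: ifP; rewrite ?lt_min ?d0.
move=> x; rewrite inE => /predU1P[->|/IH {}IH] x0; first by rewrite x0 ge_min lexx orbT.
by case: ifP; rewrite ?ge_min IH.
Qed.

(* [g] is [f] plus a small multiple of the binary code [2 ^ enum_rank i]. *)
Lemma tiebreak (R : realFieldType) (I : finType) (f : I -> R) :
  exists g : I -> R, [/\ forall i, 0 < f i -> 0 < g i,
    forall A B : {set I}, \sum_(i in A) g i <= \sum_(i in B) g i ->
      \sum_(i in A) f i <= \sum_(i in B) f i &
    forall A B : {set I}, \sum_(i in A) g i = \sum_(i in B) g i -> A = B].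
Proof.
pose sf (A : {set I}) := \sum_(i in A) f i.
have [d d0 dP] := gap [seq sf p.1 - sf p.2 | p : {set I} * {set I}].
pose c (A : {set I}) := (\sum_(i in A) 2 ^ enum_rank i)%N.
have cM A : (c A <= c setT)%N.
  by rewrite /c (big_setID A (A := setT)) setTI leq_addr.
(* [M] exceeds the code of every set, so with the factor [d / M] the perturbation of a subset sum
   stays below the gap [d]. *)
pose M : R := (c setT).+1%:R; have M0 : 0 < M by rewrite ltr0n.
pose g i := f i + d / M * (2 ^ enum_rank i)%:R.
have sg (A : {set I}) : \sum_(i in A) g i = sf A + d / M * (c A)%:R.
  by rewrite big_split /= -big_distrr /= natr_sum.
have dM0 : 0 < d / M by rewrite divr_gt0.
have mono (A B : {set I}) : \sum_(i in A) g i <= \sum_(i in B) g i -> sf A <= sf B.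
  rewrite !sg [sf A <= _]leNgt => le; apply/negP => BA.
  have : d <= sf A - sf B.
    by apply: dP; [apply/mapP; exists (A, B) => //; rewrite mem_enum | rewrite subr_gt0].
  have : d / M * (c B)%:R < d.
    by rewrite mulrAC ltr_pdivrMr // ltr_pM2l // ltr_nat ltnS.
  have : 0 <= d / M * (c A)%:R by rewrite mulr_ge0 // ltW.
  move: le; move: (d / M * (c A)%:R) (d / M * (c B)%:R) (sf A) (sf B) => a b x y.
  lra.
exists g; split=> // [i fi|A B eq]; first by rewrite addr_gt0 // mulr_gt0 // ltr0n expn_gt0.
have eqf : sf A = sf B by apply: le_anti; rewrite !mono // eq.
apply: set_code_inj; apply/eqP; rewrite -(eqr_nat R).
by move: eq; rewrite !sg eqf => /addrI /mulfI -> //; rewrite gt_eqF.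
Qed.

(** * Shortest walks and their uniqueness *)

Section Shortest.
Variables (R : realFieldType) (V : finType) (E : {set {set V}}).
Variable w : {set V} -> R.
Hypothesis w_gt0 : forall e, e \in E -> 0 < w e.
Implicit Types (x y z : V) (s t : seq V).

Definition shortest x y s := walk E x y s /\
  forall s', walk E x y s' -> cost w x s <= cost w x s'.

Lemma ex_shortest x y s : walk E x y s ->
  exists2 s', shortest x y s' & uniq (x :: s').
Proof.
move=> /simple_walk[s0 ws0 [us0 _]].
(* The minimum is taken over edge sets of simple walks, which are finite in number; any other walk
   is shortened before it is compared. *)
pose P (A : {set {set V}}) := boolp.asbool (exists2 s', walk E x y s' /\ uniq (x :: s') &
   A = [set e in edges x s']).
have P0 : P [set e in edges x s0] by apply/boolp.asboolP; exists s0.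
have [A /boolp.asboolP[s' [ws' us'] ->] min] :=
  Order.TotalTheory.arg_minP (fun A : {set {set V}} => \sum_(e in A) w e) P0.
exists s' => //; split=> // t wt; have /simple_walk[t' wt' [ut' sub]] := wt.
apply: (@le_trans _ _ (cost w x t')); last first.
  apply: le_cost => // e; case/andP: wt => _ /allP Et /Et /= eE.
  by rewrite ltW // w_gt0.
rewrite !big_edges //; apply: min; apply/boolp.asboolP; exists t' => //.
Qed.

Lemma shortest_infix x y s1 s2 s3 : shortest x y (s1 ++ s2 ++ s3) ->
  shortest (last x s1) (last (last x s1) s2) s2.
Proof.
case=> /walk_catP[w1 /walk_catP[w2 w3]] min; split=> // s' ws'.
have := min _ (walk_cat w1 (walk_cat ws' w3)).
have /andP[/eqP eq _] := ws'.
by rewrite !cost_cat eq !lerD2l lerD2r.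
Qed.

Lemma shortest_rev x y s : shortest x y s -> exists2 s', shortest y x s' &
  edges y s' = rev (edges x s) /\ (uniq (x :: s) -> uniq (y :: s')).
Proof.
case=> /rev_walk[s' ws' [es' us']] min; exists s' => //; split=> // t.
case/rev_walk=> t' wt' [et' _]; rewrite (cost_rev w es').
by rewrite -(cost_rev w et') min.
Qed.

Hypothesis w_inj : forall A B : {set {set V}},
  \sum_(e in A) w e = \sum_(e in B) w e -> A = B.

(** A simple walk costs the sum over its edge set, and by [w_inj] equal sums come only from equal
    sets. *)
Lemma shortest_unique x y s s' : shortest x y s -> shortest x y s' ->
  uniq (x :: s) -> uniq (x :: s') -> edges x s =i edges x s'.
Proof.
move=> [ws min] [ws' min'] us us'.
have eq: cost w x s = cost w x s' by apply: le_anti; rewrite min ?min'.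
move: eq; rewrite !big_edges // => /w_inj/setP eq e.
by have := eq e; rewrite !inE.
Qed.

End Shortest.

(** * Greedy spanners and the number of edges at large girth *)

Section Spanner.
Variables (R : realFieldType) (V : finType).
Implicit Types (x y z : V) (s t : seq V) (e : {set V}).
Implicit Types (E F D : {set {set V}}) (l : {set V} -> R).

Lemma set2_eq x y a b : [set x; y] = [set a; b] ->
  (x = a /\ y = b) \/ (x = b /\ y = a).
Proof.
move=> eq; have := set21 x y; have := set22 x y; have := set21 a b; have := set22 a b.
rewrite -[in b \in _]eq -[in a \in _]eq [in y \in _]eq [in x \in _]eq !in_set2.
move=> /orP[]/eqP ? /orP[]/eqP ? /orP[]/eqP ? /orP[]/eqP ?;
  by [left; split; congruence | right; split; congruence].
Qed.

Lemma mem_edgesP x s e : e \in edges x s ->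
  exists s1 b s2, s = s1 ++ b :: s2 /\ e = [set last x s1; b].
Proof.
elim: s x => //= z s IH x; rewrite inE => /predU1P[->|/IH[s1 [b [s2 [-> ->]]]]].
  by exists [::], z, s.
by exists (z :: s1), b, s2.
Qed.

Lemma size_edges x s : size (edges x s) = size s.
Proof. exact: size_pairmap. Qed.

(* Every cycle has more than [2 * q] edges. *)
Definition large_girth q E := forall x y s, [set x; y] \in E ->
  walk (E :\ [set x; y]) x y s -> (q.*2 <= size s)%N.

(** The induction removes a longest edge [e], the one that the greedy order treats last. It is added
    to the spanner of the rest only if no walk of fewer than [2q] edges there joins its ends. A walk
    of at most [2q - 1] edges, none longer than [xy], is what yields the stretch [2q - 1]. *)
Lemma greedy_spanner q D l : (0 < q)%N -> (forall e, e \in D -> #|e| = 2) ->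
  exists E, [/\ E \subset D, large_girth q E &
    forall x y, [set x; y] \in D -> exists s, [/\ walk E x y s, (size s < q.*2)%N &
      forall e, e \in edges x s -> l e <= l [set x; y]]].
Proof.
move=> q0; have [n] := ubnP #|D|; elim: n D => // n IH D leDn D2.
have [->|[e0 De0]] := set_0Vmem D.
  by exists set0; split=> [|x y s|x y]; rewrite ?sub0set ?inE.
have [e De emax] := arg_maxP l De0; have {}De : e \in D := De.
have [//||E [sED girth span]] := IH (D :\ e).
- by rewrite (cardsD1 e) De in leDn.
- by move=> f /setD1P[_ /D2].
have lE f : f \in E -> l f <= l e.
  by move=> /(subsetP sED)/setD1P[_ /emax].
have sED' : E \subset D by apply: subset_trans sED (subsetDl _ _).
have [[a [b [s [eab ws ss]]]]|no] := boolp.EM (exists a b s,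
    [/\ [set a; b] = e, walk E a b s & (size s < q.*2)%N]).
  exists E; split=> // x y Dxy.
  have [xye|ne] := eqVneq [set x; y] e; last by apply: span; rewrite !inE ne.
  have le_edges z t : {subset edges z t <= edges a s} ->
      forall f, f \in edges z t -> l f <= l e.
    move=> sub f /sub; case/andP: ws => _ /allP Es /Es; exact: lE.
  rewrite xye; move: xye; rewrite -{1}eab => /set2_eq[][-> ->].
    by exists s; split=> //; apply: le_edges.
  have [s' ws' [es' _]] := rev_walk ws; exists s'; split=> //.
    by rewrite -(size_edges b) es' size_rev size_edges.
  by apply: le_edges => f; rewrite es' mem_rev.
have far a b s : [set a; b] = e -> walk E a b s -> (q.*2 <= size s)%N.
  by move=> eab ws; rewrite leqNgt; apply/negP => ss; apply: no; exists a, b, s.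
exists (e |: E); split.
- by rewrite subUset sub1set De.
- move=> x y s0; have [xye _|ne] := eqVneq [set x; y] e.
    rewrite xye => ws; apply: far xye _; apply: walk_subset ws.
    by apply/subsetP => f; rewrite !inE; case: eqP.
  rewrite in_setU1 (negPf ne) /= => Exy /simple_walk[s ws [us sub]].
  apply: (@leq_trans (size s)); last first.
    by rewrite -!(size_edges x) uniq_leq_size // uniq_edges.
  have [es|es] := boolP (e \in edges x s); last first.
    apply: girth Exy _; apply: walk_sub (ws) => f fs.
    have := walk_edge ws fs; rewrite !inE => /andP[-> /predU1P[fe|//]].
    by rewrite -fe fs in es.
  (* The cycle formed by [xy] and [s] passes through [e]. What remains of it without [e] joins the
     ends of [e] in the old spanner and has as many edges as [s], so [far] applies. *)
  have := uniq_edges us; have [s1 [b [s2 [ss eb]]]] := mem_edgesP es.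
  move: ws; rewrite ss => /walk_catP[w1]; rewrite walk_cons => /andP[_ w2].
  rewrite edges_cat cat_uniq => /and3P[_ dis /andP[nes2 _]].
  have w1' : walk E x (last x s1) s1.
    apply: walk_sub (w1) => f fs1; have := walk_edge w1 fs1.
    rewrite !inE => /andP[_ /predU1P[fe|//]].
    by case/hasP: dis; exists f => //; rewrite fe eb /= mem_head.
  have w2' : walk E b y s2.
    apply: walk_sub (w2) => f fs2; have := walk_edge w2 fs2.
    rewrite !inE => /andP[_ /predU1P[fe|//]].
    by case/negP: nes2; rewrite -eb -fe.
  have [t1 wt1 [et1 _]] := rev_walk w1'; have [t2 wt2 [et2 _]] := rev_walk w2'.
  have wxy : walk E x b (y :: t2) by rewrite walk_cons Exy.
  have := far _ _ _ (esym eb) (walk_cat wt1 wxy).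
  have := size_edges (last x s1) t1; have := size_edges y t2.
  rewrite et1 et2 !size_rev !size_edges !size_cat /=; clear; lia.
- move=> x y; have [xye _|ne Dxy] := eqVneq [set x; y] e.
    exists [:: y]; split; last by move=> f; rewrite inE => /eqP->.
      by rewrite walk_cons walk_nil xye setU11.
    by case: (q) q0.
  have [|s [ws ss ls]] := span x y; first by rewrite !inE ne.
  by exists s; split=> //; apply: walk_subset ws; rewrite subsetU1.
Qed.

(** A relation in place of a map lets the image of [i] be found inside a proof; choice then turns it
    into an injection. *)
Lemma card_le_rel (I J : finType) (A : {set I}) (B : {set J}) (r : I -> J -> Prop) :
  (forall i, i \in A -> exists2 j, j \in B & r i j) ->
  (forall i i' j, i \in A -> i' \in A -> r i j -> r i' j -> i = i') ->
  (#|A| <= #|B|)%N.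
Proof.
move=> ex inj; have [->|[i0 Ai0]] := set_0Vmem A; first by rewrite cards0.
have [j0 _ _] := ex i0 Ai0.
have /boolp.choice[f fP] i : exists j, i \in A -> j \in B /\ r i j.
  by have [/ex[j Bj rij]|_] := boolP (i \in A); [exists j | exists j0].
rewrite -(card_in_imset (f := f)) => [|i i' Ai Ai' eq].
  by apply/subset_leq_card/subsetP => j /imsetP[i /fP[Bj _] ->].
apply: inj (Ai) (Ai') (proj2 (fP i Ai)) _; rewrite eq; exact: (proj2 (fP i' Ai')).
Qed.

Fixpoint hop_ball E v j : {set V} := if j is j'.+1
  then hop_ball E v j' :|: [set y | [exists x in hop_ball E v j', [set x; y] \in E]]
  else [set v].

Lemma hop_ball_mono E v j k : (j <= k)%N -> hop_ball E v j \subset hop_ball E v k.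
Proof.
elim: k => [|k IH]; first by rewrite leqn0 => /eqP->.
by rewrite leq_eqVlt => /predU1P[->//|/IH]; move=> /subset_trans; apply; exact: subsetUl.
Qed.

Lemma hop_ballS E v j x y : x \in hop_ball E v j -> [set x; y] \in E ->
  y \in hop_ball E v j.+1.
Proof. by move=> xj xy /=; rewrite !inE; apply/orP; right; apply/existsP; exists x; rewrite xj. Qed.

(** The last clause says that each edge of the walk meets a strictly smaller ball. Hence the walk
    avoids every edge that is first touched at radius [j]. *)
Lemma hop_ball_walk E v j y : y \in hop_ball E v j -> exists s,
  [/\ walk E v y s, (size s <= j)%N & forall e, e \in edges v s ->
     exists2 k, (k < j)%N & exists2 z, z \in e & z \in hop_ball E v k].
Proof.
elim: j y => [|j IH] y; first by rewrite inE => /eqP->; exists [::]; rewrite walk_nil.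
rewrite inE => /orP[/IH[s [ws ss es]]|].
  exists s; split=> //; first exact: leqW.
  by move=> e /es[k kj ?]; exists k => //; apply: leqW.
rewrite inE => /existsP[x /andP[xj xy]]; have [s [ws ss es]] := IH x xj.
have /andP[/eqP xs _] := ws.
exists (s ++ [:: y]); split; first by apply: walk_cat ws _; rewrite walk_cons xy walk_nil.
  by rewrite size_cat addn1.
move=> e; rewrite edges_cat mem_cat => /orP[/es[k kj ?]|].
  by exists k => //; apply: leqW.
by rewrite inE xs => /eqP->; exists j => //; exists x; rewrite ?set21.
Qed.

(* An edge first touched by the ball of radius [j <= i < q] leads out of that
   ball, and it is determined by its far end: otherwise it would lie on a cycle
   of length at most [2 * j + 2] through [v]. *)
Lemma card_touching_ball q E v i : (forall e, e \in E -> #|e| = 2) ->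
  large_girth q E -> (i < q)%N ->
  (#|[set e in E | ~~ [disjoint e & hop_ball E v i]]| <= #|hop_ball E v i.+1|)%N.
Proof.
move=> E2 girth iq.
pose first e j := (exists2 a, a \in e & a \in hop_ball E v j) /\
  forall k, (k < j)%N -> [disjoint e & hop_ball E v k].
have back e j a : first e j -> a \in hop_ball E v j ->
    exists2 s, walk (E :\ e) v a s & (size s <= j)%N.
  move=> [_ dis] /hop_ball_walk[s [ws ss es]]; exists s => //.
  apply: walk_sub (ws) => f fs; rewrite !inE.
  have /andP[_ /allP/(_ f fs) /= ->] := ws; rewrite andbT.
  have [k kj [z zf zk]] := es f fs; apply: contraTneq zf => ->.
  by apply/negP => ze; rewrite (disjointFr (dis k kj) ze) in zk.
pose r e b := exists j a, [/\ (j <= i)%N, first e j, e = [set a; b],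
  a \in hop_ball E v j & b \in hop_ball E v j.+1 :\: hop_ball E v j].
apply: (card_le_rel (r := r)).
- move=> e; rewrite inE => /andP[Ee touch].
  pose P j := ~~ [disjoint e & hop_ball E v j].
  have [|j Pj jmin] := @ex_minnP P; first by exists i.
  have ji : (j <= i)%N by apply: jmin.
  have fst : first e j.
    split; first by case/pred0Pn: Pj => a /andP[ae aj]; exists a.
    by move=> k; rewrite ltnNge; apply: contraNT => /jmin.
  have [[a ae aj] _] := fst.
  have /eqP/cards2P[x [y [xy exy]]] := E2 e Ee.
  have [b eab] : exists b, e = [set a; b].
    by move: ae; rewrite exy !inE => /orP[]/eqP->; [exists y | exists x; rewrite setUC].
  have bj1 : b \in hop_ball E v j.+1 by apply: hop_ballS aj _; rewrite -eab.
  have bj : b \notin hop_ball E v j.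
    apply/negP => bj; have [s ws ss] := back _ _ _ fst aj.
    have [t wt st] := back _ _ _ fst bj; have [s' ws' [es' _]] := rev_walk ws.
    have := girth a b (s' ++ t); rewrite -eab => /(_ Ee (walk_cat ws' wt)).
    have := size_edges a s'; rewrite es' size_rev size_edges size_cat.
    move: (iq) (ji) (ss) (st); clear; lia.
  exists b; first by apply: (subsetP (hop_ball_mono E v _)) bj1; rewrite ltnS.
  by exists j, a; split=> //; rewrite inE bj.
- move=> e e' b; rewrite !inE => /andP[Ee _] /andP[Ee' _].
  move=> [j [a [ji fst ea aj /setDP[bj1 bj]]]] [j' [a' [ji' _ ea' aj' /setDP[bj1' bj']]]].
  have jj' : j = j'.
    apply/eqP; rewrite eqn_leq; apply/andP; split; rewrite leqNgt; apply/negP => lt.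
      by have /subsetP/(_ b bj1') := hop_ball_mono E v lt; apply/negP.
    by have /subsetP/(_ b bj1) := hop_ball_mono E v lt; apply/negP.
  rewrite -jj' in aj'; have [//|ne] := eqVneq e e'.
  have [s ws ss] := back _ _ _ fst aj; have [t wt st] := back _ _ _ fst aj'.
  have [s' ws' [es' _]] := rev_walk ws.
  have wb : walk (E :\ e) a' b [:: b].
    by rewrite walk_cons walk_nil -ea' !inE eq_sym ne Ee'.
  have := girth a b (s' ++ (t ++ [:: b])); rewrite -ea.
  move=> /(_ Ee (walk_cat ws' (walk_cat wt wb))).
  have := size_edges a s'; rewrite es' size_rev size_edges !size_cat /=.
  move: (iq) (ji) (ss) (st); clear; lia.
Qed.

(* A ball that grows by a factor at most [r] is found below radius [q]; removing
   it costs at most [r] edges per vertex. *)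
Lemma moore_bound q (r : R) (U : {set V}) E : (0 < q)%N -> 0 <= r ->
  #|U|%:R <= r ^+ q -> (forall e, e \in E -> #|e| = 2 /\ e \subset U) ->
  large_girth q E -> #|E|%:R <= r * #|U|%:R.
Proof.
move=> q0 r0; have [n] := ubnP #|U|; elim: n U E => // n IH U E leUn leUr EU girth.
have [E0|[e Ee]] := set_0Vmem E; first by rewrite E0 cards0 mulr_ge0.
have [e2 eU] := EU e Ee.
have [v ve] : exists v, v \in e by apply/set0Pn; rewrite -card_gt0 e2.
have vU := subsetP eU v ve.
pose B := hop_ball E v.
have BU j : B j \subset U.
  elim: j => [|j IHj]; first by rewrite sub1set.
  rewrite subUset IHj; apply/subsetP => y; rewrite inE => /existsP[x /andP[_ /EU[_]]].
  by move/subsetP; apply; rewrite set22.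
(* Otherwise every ball up to radius [q] would have more than [r] times the size of the previous
   one, and [B q] would have more than [r ^ q] vertices, although it lies in [U]. *)
have [i iq Bi] : exists2 i, (i < q)%N & #|B i.+1|%:R <= r * #|B i|%:R.
  have [//|no] := boolp.EM (exists2 i, (i < q)%N & #|B i.+1|%:R <= r * #|B i|%:R).
  have grow i : (i < q)%N -> r * #|B i|%:R < #|B i.+1|%:R.
    by move=> iq; rewrite ltNge; apply/negP => le; apply: no; exists i.
  have pow i : (i < q)%N -> r ^+ i.+1 < #|B i.+1|%:R.
    elim: i => [|i IHi] iq; first by have := grow 0%N iq; rewrite /B /= cards1 mulr1.
    apply: le_lt_trans (grow _ iq); rewrite exprS ler_wpM2l //.
    by apply/ltW/IHi; rewrite ltnW.
  have := pow q.-1; rewrite prednK // leqnn => /(_ isT).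
  have : #|B q|%:R <= r ^+ q by apply: le_trans leUr; rewrite ler_nat subset_leq_card.
  by move=> /le_lt_trans le /le; rewrite ltxx.
have vB : v \in B i by apply: (subsetP (hop_ball_mono E v (leq0n i))); rewrite inE.
pose E1 := [set e in E | ~~ [disjoint e & B i]].
have cU : #|U| = (#|U :\: B i| + #|B i|)%N.
  by rewrite -(cardsID (B i) U) addnC (setIidPr (BU i)).
have B0 : (0 < #|B i|)%N by apply/card_gt0P; exists v.
have leE : #|E :\: E1|%:R <= r * #|U :\: B i|%:R.
  apply: IH.
  - by move: (B0) leUn; rewrite cU; clear; lia.
  - by apply: le_trans leUr; rewrite ler_nat cU leq_addr.
  - move=> f; rewrite !inE => /andP[+ Ef]; rewrite Ef negbK /= => dis.
    by have [f2 fU] := EU f Ef; rewrite subsetD fU.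
  - move=> x y s; rewrite !inE => /andP[_ Exy] ws; apply: girth Exy _.
    by apply: walk_subset ws; apply: setSD; exact: subsetDl.
have leE1 : #|E1|%:R <= r * #|B i|%:R.
  apply: le_trans Bi; rewrite ler_nat; apply: card_touching_ball girth iq => f Ef.
  by have [] := EU f Ef.
have -> : #|E| = (#|E :\: E1| + #|E1|)%N.
  rewrite -(cardsID E1 E) addnC (setIidPr _) //.
  by apply/subsetP => f; rewrite inE => /andP[].
by rewrite cU !natrD mulrDr lerD.
Qed.

End Spanner.

(** * Intersections of unique shortest paths, and the realised spanner *)

Section Terminals.
Variables (R : realFieldType) (V : finType).
Implicit Types (x y z u v : V) (s t : seq V) (e : {set V}).
Implicit Types (S : {set V}) (E F D : {set {set V}}) (l w : {set V} -> R).

Definition edge_set x s : {set {set V}} := [set e in edges x s].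

Lemma card_nbhd_head x s : uniq (x :: s) -> (#|nbhd (edge_set x s) x| <= 1)%N.
Proof.
case: s => [|z s].
  by move=> _; rewrite leqW // leqn0 cards_eq0; apply/eqP/setP => y; rewrite !inE.
move=> /andP[xs _]; rewrite -(cards1 z); apply/subset_leq_card/subsetP => y.
rewrite !inE => /predU1P[/set2_eq[[_ ->]|[-> ->]]//|/edges_subset/(_ x (set21 _ _))].
by rewrite (negPf xs).
Qed.

Lemma card_nbhd_path x s v : uniq (x :: s) -> (#|nbhd (edge_set x s) v| <= 2)%N.
Proof.
elim: s x => [|z s IH] x us.
  by rewrite leqW // leqW // leqn0 cards_eq0; apply/eqP/setP => y; rewrite !inE.
have [->|vx] := eqVneq v x; first by rewrite leqW // card_nbhd_head.
have uzs : uniq (z :: s) by case/andP: us.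
have [->|vz] := eqVneq v z.
  apply: (@leq_trans #|x |: nbhd (edge_set z s) z|).
    apply/subset_leq_card/subsetP => y; rewrite !inE.
    by case/predU1P=> [/set2_eq[[zx ->]|[_ ->]]|->]; rewrite ?zx ?eqxx ?orbT.
  by rewrite cardsU1; apply: leq_add (leq_b1 _) (card_nbhd_head uzs).
apply: leq_trans (IH _ uzs); apply/subset_leq_card/subsetP => y; rewrite !inE.
by case/predU1P=> [/set2_eq[][]|//] ev _; [rewrite ev eqxx in vx | rewrite ev eqxx in vz].
Qed.

Lemma split_at x s y : y \in x :: s -> exists s1 s2, s = s1 ++ s2 /\ last x s1 = y.
Proof. by case/splitPl=> s1 s2 <-; exists s1, s2. Qed.

Lemma uniq_infix x s1 s2 s3 : uniq (x :: s1 ++ s2 ++ s3) -> uniq (last x s1 :: s2).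
Proof.
by rewrite -cat_cons lastI cat_rcons -cat_cons !cat_uniq => /and3P[_ _ /and3P[->]].
Qed.

Variables (E : {set {set V}}) (w : {set V} -> R).
Hypothesis w_gt0 : forall e, e \in E -> 0 < w e.
Hypothesis w_inj : forall A B : {set {set V}},
  \sum_(e in A) w e = \sum_(e in B) w e -> A = B.

(** The part of the path between [u] and [z] serves, reversed if [z] comes before [u]. *)
Lemma shortest_between x y s u z : shortest E w x y s -> uniq (x :: s) ->
  u \in x :: s -> z \in x :: s -> exists t,
  [/\ shortest E w u z t, uniq (u :: t) & {subset edges u t <= edges x s}].
Proof.
move=> min us /split_at[q1 [q2 [sE q1u]]]; rewrite sE in us min *.
rewrite -cat_cons mem_cat => /orP[/split_at[q3 [q4 [qE q3z]]]|z2].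
  rewrite qE -catA in us min q1u *; have := shortest_infix min.
  rewrite last_cat q3z in q1u *; rewrite q1u => /shortest_rev[t mt [et ut]].
  exists t; split=> //; first by apply: ut; rewrite -q3z; exact: uniq_infix us.
  by move=> e; rewrite et mem_rev edges_cat q3z edges_cat !mem_cat => ->; rewrite orbT.
have [q3 [q4 [qE q3z]]] : exists q3 q4, q2 = q3 ++ q4 /\ last u q3 = z.
  by apply: split_at; rewrite inE z2 orbT.
rewrite qE in us min *; have := shortest_infix min; rewrite q1u q3z => mt.
exists q3; split=> //; first by rewrite -q1u; exact: uniq_infix us.
by move=> e es; rewrite edges_cat q1u edges_cat !mem_cat es orbT.
Qed.

(* Otherwise the two paths, being unique shortest paths, would share a subpath
   with [v] in its interior, and [v] would have three neighbours on the second. *)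
Lemma branching_vertex x1 y1 s1 x2 y2 s2 v y :
  shortest E w x1 y1 s1 -> uniq (x1 :: s1) ->
  shortest E w x2 y2 s2 -> uniq (x2 :: s2) ->
  v \in x1 :: s1 -> [set v; y] \in edges x2 s2 -> [set v; y] \notin edges x1 s1 ->
  let common := filter [in x2 :: s2] (x1 :: s1) in
  v = head x1 common \/ v = last x1 common.
Proof.
move=> min1 u1 min2 u2 v1 vy2 vy1; have v2 := edges_subset vy2 (set21 _ _).
have [p [r [s1E pv]]] := split_at v1.
have -> : x1 :: s1 = belast x1 p ++ v :: r by rewrite s1E -cat_cons lastI pv cat_rcons.
rewrite filter_cat /= v2.
have [/hasP[u u1' u2']|nu] := boolP (has [in x2 :: s2] (belast x1 p)); last first.
  by left; move: nu; rewrite has_filter negbK => /eqP->.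
have [/hasP[z z1 z2]|nz] := boolP (has [in x2 :: s2] r); last first.
  by right; move: nz; rewrite has_filter negbK last_cat /= => /eqP->.
exfalso.
(* [u] and [z] are common vertices before and after [v], and [p2 ++ r1] is the first path between
   them. By uniqueness its edges lie on the second path. *)
have [p1 [p2 [pE p1u]]] : exists p1 p2, p = p1 ++ p2 /\ last x1 p1 = u.
  by apply: split_at; exact: mem_belast.
have [r1 [r2 [rE r1z]]] : exists r1 r2, r = r1 ++ r2 /\ last v r1 = z.
  by apply: split_at; rewrite inE z1 orbT.
have p2v : last u p2 = v by rewrite -pv pE last_cat p1u.
have sub1 : shortest E w u z (p2 ++ r1).
  have := min1; rewrite s1E pE rE -!catA [p2 ++ _]catA => /shortest_infix.
  by rewrite p1u last_cat p2v r1z.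
have usub1 : uniq (u :: p2 ++ r1).
  have := u1; rewrite s1E pE rE -!catA [p2 ++ _]catA => /uniq_infix.
  by rewrite p1u.
have [t [min_t ut sub_t]] := shortest_between min2 u2 u2' z2.
have eqt := shortest_unique w_inj sub1 min_t usub1 ut.
have [p3 [a p2E]] : exists p3 a, p2 = rcons p3 a.
  case/lastP: (p2) p2v => [/= uv|p3 a _]; last by exists p3, a.
  move: u1; rewrite s1E -cat_cons lastI pv cat_rcons cat_uniq => /and3P[_ /hasPn/(_ v)].
  by rewrite inE eqxx => /(_ isT) /=; rewrite -uv u1'.
have [b [r3 r1E]] : exists b r3, r1 = b :: r3.
  case: (r1) r1z => [/= vz|b r3 _]; last by exists b, r3.
  move: u1; rewrite s1E -cat_cons lastI pv cat_rcons cat_uniq => /and3P[_ _] /=.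
  by rewrite vz z1.
have vE : v = a by move: p2v; rewrite p2E last_rcons.
pose c := last u p3.
have cv : [set v; c] \in edges u (p2 ++ r1).
  by rewrite p2E -cats1 -catA edges_cat mem_cat /= setUC -vE mem_head orbT.
have bv : [set v; b] \in edges u (p2 ++ r1).
  by rewrite edges_cat mem_cat p2v r1E mem_head orbT.
have cb : c != b.
  move: usub1; rewrite p2E r1E -cats1 -catA -cat_cons lastI cat_rcons cat_uniq.
  by case/and3P=> _ _ /= /andP[]; rewrite !inE !negb_or => /and3P[_ ? _].
have := card_nbhd_path v u2; rewrite leqNgt => /negP; apply.
have sub_s1 f : f \in edges u (p2 ++ r1) -> f \in edges x1 s1.
  move=> fs; rewrite s1E pE rE -!catA [p2 ++ (r1 ++ _)]catA edges_cat p1u edges_cat.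
  by rewrite !mem_cat fs orbT.
(* [c] and [b] precede and follow [v] on the first path; [y] differs from both since [vy] is not an
   edge of that path. *)
apply: (@leq_trans #|[set y; c; b]|).
  rewrite -setUA cardsU1 cards2 cb !inE negb_or.
  by rewrite (contraNneq _ vy1) ?(contraNneq _ vy1) // => ->; apply: sub_s1.
apply/subset_leq_card/subsetP => d; rewrite !inE.
by case/orP=> [/orP[]|] /eqP-> //; apply: sub_t; rewrite -eqt.
Qed.

End Terminals.

(** Stretch is expressed by walks and not by distances: it composes without infima, and asks nothing
    about vertices in different components. *)
Definition dominates (R : realFieldType) (V : finType) (a : R) (S : {set V})
    (E : {set {set V}}) (l : {set V} -> R) (F : {set {set V}}) (l' : {set V} -> R) :=
  forall x y s, x \in S -> y \in S -> walk E x y s ->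
    exists2 t, walk F x y t & cost l' x t <= a * cost l x s.

Lemma cost_ge0 (R : realFieldType) (V : finType) (E : {set {set V}})
    (l : {set V} -> R) (x y : V) s :
  (forall e, e \in E -> 0 < l e) -> walk E x y s -> 0 <= cost l x s.
Proof.
move=> l0 ws; rewrite /cost big_seq sumr_ge0 // => e es.
exact/ltW/l0/(walk_edge ws).
Qed.

(** By [moore_bound] there are at most [r * #|S|] spanner edges. A vertex with three neighbours in
    the union of their paths is the first or the last common vertex of an ordered pair of paths,
    whence the factor 2 and the square. *)
Lemma terminal_spanner (R : realFieldType) (V : finType) (E : {set {set V}})
    (l : {set V} -> R) (S : {set V}) (q : nat) (r : R) :
  (forall e, e \in E -> 0 < l e) -> (0 < q)%N -> 0 <= r -> #|S|%:R <= r ^+ q ->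
  exists F : {set {set V}}, [/\ F \subset E, dominates (2 * q%:R - 1) S E l F l &
    #|[set x | (2 < #|nbhd F x|)%N]|%:R <= 2 * (r * #|S|%:R) ^+ 2].
Proof.
move=> l0 q0 r0 Sr; have [S0|[x0 Sx0]] := set_0Vmem S.
  exists set0; split; rewrite ?sub0set //; first by move=> x y s; rewrite S0 inE.
  rewrite [X in #|pred_of_set X|](_ : _ = set0) ?cards0 ?mulr_ge0 ?exprn_ge0 ?mulr_ge0 //.
  apply/setP => x; rewrite !inE [nbhd _ _](_ : _ = set0) ?cards0 //.
  by apply/setP => y; rewrite !inE.
have [w [w0 wl winj]] := tiebreak l.
have {}w0 e : e \in E -> 0 < w e by move=> /l0/w0.
(* Since [tiebreak] preserves the order of subset sums, a [w]-shortest simple path is [l]-shortest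
   too. *)
have shortest_l x y s s' : shortest E w x y s -> uniq (x :: s) -> walk E x y s' ->
    cost l x s <= cost l x s'.
  move=> [ws min] us ws'; have [t wt [ut sub]] := simple_walk ws'.
  apply: (@le_trans _ _ (cost l x t)).
    by rewrite !big_edges //; apply: wl; rewrite -!big_edges // min.
  by apply: le_cost => // e es; apply/ltW/l0/(walk_edge ws').
pose joined e x s := [/\ e = [set x; last x s], shortest E w x (last x s) s & uniq (x :: s)].
(* [D] joins all pairs of distinct vertices of [S] that are connected in [E]; [len] below is the
   distance between the ends of such a pair. *)
pose D := [set e : {set V} | [&& e \subset S, #|e| == 2 &
  boolp.asbool (exists x s, joined e x s)]].
have mem_D x y s : x \in S -> y \in S -> x != y -> walk E x y s -> [set x; y] \in D.
  move=> xS yS xy ws; rewrite inE cards2 xy subUset !sub1set xS yS /=.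
  have [s' ms' us'] := ex_shortest w0 ws; apply/boolp.asboolP; exists x, s'.
  by rewrite /joined (walk_last (proj1 ms')).
have /boolp.choice[p pP] e : exists p, e \in D -> joined e p.1 p.2.
  have [|_] := boolP (e \in D); last by exists (x0, [::]).
  by rewrite inE => /and3P[_ _ /boolp.asboolP[x [s xs]]]; exists (x, s).
pose len e := cost l (p e).1 (p e).2.
have D2 e : e \in D -> #|e| = 2 by rewrite inE => /and3P[_ /eqP].
have [D' [sD' girth span]] := greedy_spanner len q0 D2.
pose F := \bigcup_(e in D') edge_set (p e).1 (p e).2.
have pD' e : e \in D' -> joined e (p e).1 (p e).2 by move=> /(subsetP sD')/pP.
have walkF a b : [set a; b] \in D' -> exists2 t, walk F a b t & cost l a t = len [set a; b].
  move=> ab; have [+ [ws _] us] := pD' _ ab.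
  have : walk F (p [set a; b]).1 (last (p [set a; b]).1 (p [set a; b]).2) (p [set a; b]).2.
    by apply: walk_sub ws => f fs; apply/bigcupP; exists [set a; b]; rewrite ?inE.
  rewrite /len; move: (p [set a; b]) => [x s] /= {}ws; case/set2_eq=> -[-> ->].
    by exists s.
  by have [t wt [et _]] := rev_walk ws; exists t => //; exact: cost_rev et.
have len_min x y s : [set x; y] \in D -> walk E x y s -> len [set x; y] <= cost l x s.
  move=> xy ws; have [] := pP _ xy.
  rewrite /len; move: (p [set x; y]) => [u t] /= /set2_eq[][xu yu] min us.
    by rewrite xu; apply: shortest_l min us _; rewrite -yu -xu.
  have [s' ws' [es' _]] := rev_walk ws; rewrite -(cost_rev l es') yu.
  by apply: shortest_l min us _; rewrite -xu -yu.
have cardD' : #|D'|%:R <= r * #|S|%:R.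
  apply: (moore_bound q0 r0 Sr) girth => e De; have {}De := subsetP sD' e De.
  by split; [apply: D2 | move: De; rewrite inE => /and3P[]].
exists F; split.
- apply/bigcupsP => e De; apply/subsetP => f; rewrite inE.
  by have [_ [ws _] _] := pD' e De; apply: walk_edge ws.
- move=> x y s xS yS ws; have [xy|xy] := eqVneq x y.
    exists [::]; first by rewrite xy walk_nil.
    rewrite cost_nil; apply: mulr_ge0 (cost_ge0 l0 ws).
    by rewrite subr_ge0 -natrM ler1n muln_gt0.
  have Dxy := mem_D _ _ _ xS yS xy ws; have [h [wh sh lh]] := span x y Dxy.
  (* [h] has at most [2q - 1] edges, none longer than [len [set x; y]], so each may be charged this
     constant weight. *)
  have [t wt ct] : exists2 t, walk F x y t &
      cost l x t <= 1 * cost (fun=> len [set x; y]) x h.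
    apply: walk_expand (wh) => a b ab; have [t wt ct] := walkF _ _ (walk_edge wh ab).
    by exists t; rewrite // ct mul1r lh.
  exists t => //; apply: (le_trans ct); rewrite mul1r.
  rewrite /cost big_const_seq count_predT size_edges iter_addr_0 -[_ *+ size h]mulr_natl.
  have lxy := len_min _ _ _ Dxy ws.
  apply: ler_pM _ _ _ lxy; rewrite ?ler0n //.
    have [_ [wp _] _] := pP _ Dxy; exact: cost_ge0 l0 wp.
  by rewrite lerBrDr -natrM natr1 ler_nat mul2n.
have bound : (#|[set x | (2 < #|nbhd F x|)%N]| <= #|setX (setX D' D') [set: bool]|)%N.
  pose common e e' := filter [in (p e').1 :: (p e').2] ((p e).1 :: (p e).2).
  apply: (card_le_rel (r := fun v (k : {set V} * {set V} * bool) =>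
    v = (if k.2 then head else last) (p k.1.1).1 (common k.1.1 k.1.2))).
    move=> v; rewrite inE => v3.
    have [y] : exists y, y \in nbhd F v by apply/card_gt0P; rewrite (leq_trans _ v3).
    rewrite inE => /bigcupP[e De]; rewrite inE => vy.
    have [_ min us] := pD' e De.
    (* The path of [e] gives [v] at most two neighbours, so some edge at [v] lies on the path of
       another spanner edge [e'] and not on this one. *)
    have /subsetPn[y' + ny'] : ~~ (nbhd F v \subset nbhd (edge_set (p e).1 (p e).2) v).
      apply/negP => /subset_leq_card le.
      by have := leq_trans v3 (leq_trans le (card_nbhd_path v us)); rewrite ltnn.
    rewrite inE => /bigcupP[e' De']; rewrite inE => vy'.
    have [_ min' us'] := pD' e' De'.
    have := branching_vertex winj min us min' us' (edges_subset vy (set21 _ _)) vy'.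
    rewrite !inE in ny' => /(_ ny') /= [] vE.
      by exists (e, e', true); rewrite // !inE De De'.
    by exists (e, e', false); rewrite // !inE De De'.
  by move=> v v' k _ _ -> ->.
apply: (@le_trans _ _ (2 * #|D'|%:R ^+ 2)).
  by rewrite -natrX -natrM ler_nat (leq_trans bound) // !cardsX cardsT card_bool mulnC.
by rewrite ler_pM2l // ler_pXn2r // nnegrE ?mulr_ge0.
Qed.

(** * Minors and the suppression of vertices of small degree *)

Lemma dominates_trans (R : realFieldType) (V : finType) (a b : R) (S : {set V})
    (E F K : {set {set V}}) (l l' l'' : {set V} -> R) :
  0 <= b -> dominates a S E l F l' -> dominates b S F l' K l'' ->
  dominates (b * a) S E l K l''.
Proof.
move=> b0 dE dF x y s xS yS ws; have [t wt ct] := dE x y s xS yS ws.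
have [u wu cu] := dF x y t xS yS wt; exists u => //.
by apply: le_trans cu _; rewrite -mulrA ler_wpM2l.
Qed.

Lemma dominates_refl (R : realFieldType) (V : finType) (S : {set V})
    (E : {set {set V}}) (l : {set V} -> R) : dominates 1 S E l E l.
Proof. by move=> x y s _ _ ws; exists s; rewrite // mul1r. Qed.

Lemma dominates_subset (R : realFieldType) (V : finType) (a : R) (S T : {set V})
    (E F : {set {set V}}) (l l' : {set V} -> R) :
  T \subset S -> dominates a S E l F l' -> dominates a T E l F l'.
Proof. by move=> /subsetP TS d x y s /TS xS /TS yS; apply: d. Qed.

Lemma minor_trans (V : finType) (T : {set V}) (G H K : graph V) :
  minor T G H -> minor T H K -> minor T G K.
Proof. by move=> GH; elim=> //; econstructor; eassumption. Qed.

Lemma minor_subset (V : finType) (S T : {set V}) (G H : graph V) :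
  T \subset S -> minor S G H -> minor T G H.
Proof.
move=> /subsetP TS; have {}TS v : v \notin S -> v \notin T by apply: contra; apply: TS.
elim=> *; [exact: minor_refl|apply: minor_del_vertex|apply: minor_del_edge|
  apply: minor_contract]; by [|apply: TS].
Qed.

Lemma spanning_subgraph_minor (V : finType) (T : {set V}) (G : graph V)
    (F : {set {set V}}) :
  F \subset eset G ->
  exists H : graph V, [/\ minor T G H, vset H = vset G & eset H = F].
Proof.
have [n] := ubnP #|eset G :\: F|; elim: n G => // n IH G leGn sFG.
have [/eqP|[e eGF]] := set_0Vmem (eset G :\: F).
  rewrite setD_eq0 => sGF; exists G; split; first exact: minor_refl; first by [].
  by apply/eqP; rewrite eqEsubset sGF.
have [eF eG] := setDP eGF.
have [||H [mH vH eH]] := IH (del_edge G e).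
- by rewrite /= setDDl setUC -setDDl; rewrite (cardsD1 e) eGF in leGn.
- by rewrite subsetD1 sFG.
exists H; split=> //; apply: minor_trans mH; apply: minor_del_edge => //.
exact: minor_refl.
Qed.

(** A passage [x, v, z] of the walk becomes the edge [xz], or is dropped if [x = z]. The statement
    serves both the deletion of a vertex with at most one neighbour, where the last hypothesis is
    vacuous, and the contraction of a vertex with two. *)
Lemma skip_vertex (R : realFieldType) (V : finType) (E F : {set {set V}})
    (l l' : {set V} -> R) (v : V) :
  (forall e, e \in E -> 0 <= l e) -> [set v] \notin E ->
  (forall e, e \in E -> v \notin e -> e \in F /\ l' e <= l e) ->
  (forall x z, [set x; v] \in E -> [set v; z] \in E -> x != z ->
     [set x; z] \in F /\ l' [set x; z] <= l [set x; v] + l [set v; z]) ->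
  dominates 1 (~: [set v]) E l F l'.
Proof.
move=> l0 nv away through x y s; rewrite !inE.
have [n] := ubnP (size s); elim: n s x => // n IH [|z s] x.
  by move=> _ xv yv /andP[/eqP <- _]; exists [::]; rewrite ?walk_nil ?mul1r ?cost_nil.
move=> sn xv yv; rewrite walk_cons => /andP[xz ws].
have [zv|zv] := eqVneq z v; last first.
  have [t wt ct] := IH s z sn zv yv ws.
  have [|xzF lxz] := away _ xz; first by rewrite !inE negb_or eq_sym xv eq_sym zv.
  exists (z :: t); first by rewrite walk_cons xzF.
  by rewrite !cost_cons mul1r; rewrite mul1r in ct; rewrite lerD.
rewrite zv in xz ws *; case: s sn ws => [_ /andP[/eqP vy _]|z' s].
  by rewrite -vy eqxx in yv.
move=> sn; rewrite walk_cons => /andP[vz' ws].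
have z'v : z' != v by apply: contraNneq nv => z'v; rewrite z'v setUid in vz'.
have [t wt ct] := IH s z' (ltnW sn) z'v yv ws; rewrite mul1r in ct.
have [xz'|xz'] := eqVneq x z'.
  exists t; rewrite ?xz' // mul1r !cost_cons; apply: (le_trans ct).
  by rewrite addrA lerDr addr_ge0 ?l0 // -xz'.
have [xzF lxz] := through _ _ xz vz' xz'.
exists (z' :: t); first by rewrite walk_cons xzF.
by rewrite mul1r !cost_cons addrA lerD.
Qed.

Lemma loopless (V : finType) (G : graph V) v : [set v] \notin eset G.
Proof. by apply/negP => /esetP/andP[_]; rewrite cards1. Qed.

Lemma nbhdC (V : finType) (E : {set {set V}}) x y : (x \in nbhd E y) = (y \in nbhd E x).
Proof. by rewrite !inE setUC. Qed.

Lemma contract_vset (V : finType) (G : graph V) a v :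
  a \in vset G -> a != v -> vset (Defs.contract G a v) = vset G :\ v.
Proof.
move=> Ga av; apply/setP => x; rewrite !inE; apply/imsetP/andP => [[y Gy ->]|[xv Gx]].
  by rewrite /Defs.merge; case: ifPn.
by exists x => //; rewrite /Defs.merge (negPf xv).
Qed.

(** The edge [va] collapses to a singleton and is discarded, [vb] becomes [ab], and edges away from
    [v] stay. *)
Lemma contract_eset (V : finType) (G : graph V) a b v :
  a != b -> nbhd (eset G) v = [set a; b] ->
  eset (Defs.contract G a v) = [set a; b] |: [set e in eset G | v \notin e].
Proof.
move=> ab nv; have vy y : [set v; y] \in eset G = (y \in [set a; b]) by rewrite -nv inE.
have vneq y : y \in [set a; b] -> y != v.
  by rewrite -vy; apply: contraTneq => ->; rewrite setUid loopless.
have mergeid (e : {set V}) : v \notin e -> Defs.merge a v @: e = e.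
  move=> ve; rewrite -[RHS]imset_id; apply: eq_in_imset => x xe; rewrite /Defs.merge.
  by case: eqP => // xv; rewrite -xv xe in ve.
have mergev y : y \in [set a; b] -> Defs.merge a v @: [set v; y] = [set a; y].
  move=> /vneq yv; rewrite imsetU1 imset_set1 /Defs.merge eqxx (negPf yv) //.
apply/setP => e; rewrite inE in_setU1 inE; apply/andP/orP.
  case=> /imsetP[f Gf ->]; have [vf|vf] := boolP (v \in f); last first.
    by rewrite mergeid // => _; right; rewrite Gf.
  have [_ /cards2P[x [y [_ fxy]]]] := andP (esetP Gf).
  have [z fvz] : exists z, f = [set v; z].
    by move: vf; rewrite fxy !inE => /orP[]/eqP->; [exists y | exists x; rewrite setUC].
  move: Gf; rewrite fvz vy => zab; rewrite mergev //; move: zab.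
  by rewrite !inE => /orP[]/eqP->; rewrite ?setUid ?cards1 ?eqxx //; left.
case=> [/eqP->|/andP[Ge ve]].
  split; last by rewrite cards2 ab.
  by apply/imsetP; exists [set v; b]; rewrite ?vy ?mergev ?set22.
split; last by have /andP[] := esetP Ge.
by apply/imsetP; exists e; rewrite ?mergeid.
Qed.

(** With at most one neighbour [v] is deleted, with two it is contracted into one of them. No degree
    grows: a neighbour of [v] that gains the edge [ab] loses its edge to [v]. So no new branching
    vertex can arise. *)
Lemma remove_vertex (R : realType) (V : finType) (S : {set V}) (G : wgraph R V) v :
  v \in vset G -> v \notin S -> (#|nbhd (eset G) v| <= 2)%N ->
  exists H : wgraph R V, [/\ minor S G H, vset H = vset G :\ v,
    dominates 1 S (eset G) (len G) (eset H) (len H),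
    dominates 1 S (eset H) (len H) (eset G) (len G) &
    forall x, (#|nbhd (eset H) x| <= #|nbhd (eset G) x|)%N].
Proof.
move=> Gv vS; have sS : S \subset ~: [set v] by rewrite subsetC sub1set inE.
have lenG0 e : e \in eset G -> 0 <= len G e by move=> /len_gt0/ltW.
rewrite leq_eqVlt => /predU1P[/eqP/cards2P[a [b [ab nv]]]|nv]; last first.
  have H0 e : e \in eset (del_vertex G v) -> 0 < len G e.
    by rewrite inE => /andP[/len_gt0].
  exists (WGraph H0); split=> //.
  - by apply: minor_del_vertex => //; exact: minor_refl.
  - apply: dominates_subset sS _; apply: skip_vertex => //.
    + exact: loopless.
    + by move=> e Ge ve; rewrite inE Ge ve.
    move=> x z xv vz xz; move: nv; rewrite ltnNge => /negP[].
    have <- : #|[set x; z]| = 2%N by rewrite cards2 xz.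
    by apply/subset_leq_card; rewrite subUset !sub1set !inE setUC xv vz.
  - apply: dominates_subset (subsetT S) _ => x y s _ _ ws; exists s; rewrite ?mul1r //.
    by apply: walk_subset ws; apply/subsetP => e; rewrite inE => /andP[].
  - move=> x; apply/subset_leq_card/subsetP => y.
    by rewrite !inE => /andP[].
have vy y : [set v; y] \in eset G = (y \in [set a; b]) by rewrite -nv inE.
have Gva : [set v; a] \in eset G by rewrite vy set21.
have Gvb : [set v; b] \in eset G by rewrite vy set22.
have va : v != a by apply: contraTneq Gva => <-; rewrite setUid loopless.
have vb : v != b by apply: contraTneq Gvb => <-; rewrite setUid loopless.
have Ga : a \in vset G.
  by have /andP[/subsetP sub _] := esetP Gva; apply: sub; rewrite set22.
pose c := len G [set v; a] + len G [set v; b].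
have c0 : 0 < c by rewrite addr_gt0 ?len_gt0.
(* The edge [ab] may already exist; it then gets the smaller of its own length and that of the path
   through [v]. *)
pose l e := if e != [set a; b] then len G e
  else if [set a; b] \in eset G then Order.min (len G [set a; b]) c else c.
have eH := contract_eset ab nv.
have l0 e : e \in eset (Defs.contract G a v) -> 0 < l e.
  rewrite eH in_setU1 inE /l; case: eqP => [_ _|_ /andP[Ge _]] /=; last exact: len_gt0.
  by case: ifP => // Gab; rewrite lt_min len_gt0.
have lab : l [set a; b] <= c by rewrite /l eqxx /=; case: ifP => // _; rewrite ge_min lexx orbT.
(* A walk of [G] is as short as the new edge, so distances do not drop. *)
have [t [wt ct]] : exists t, walk (eset G) a b t /\ cost (len G) a t <= l [set a; b].
  rewrite /l eqxx /=; have [Gab|_] := boolP ([set a; b] \in eset G); last first.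
    exists [:: v; b]; rewrite !walk_cons walk_nil setUC Gva Gvb; split=> //.
    by rewrite !cost_cons cost_nil addr0 setUC.
  have [_|_] := leP (len G [set a; b]) c.
    by exists [:: b]; rewrite walk_cons Gab walk_nil cost_cons cost_nil addr0.
  exists [:: v; b]; rewrite !walk_cons walk_nil setUC Gva Gvb; split=> //.
  by rewrite !cost_cons cost_nil addr0 setUC.
have degree x o : x != v -> [set x; o] = [set a; b] ->
    (#|nbhd (eset (Defs.contract G a v)) x| <= #|nbhd (eset G) x|)%N.
  move=> xv xo; apply: (@leq_trans #|o |: (nbhd (eset G) x :\ v)|).
    apply/subset_leq_card/subsetP => y; rewrite inE eH -xo !inE.
    case/orP=> [/eqP/set2_eq[[_ ->]|[-> ->]]|/andP[->]]; rewrite ?eqxx //.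
    by rewrite negb_or => /andP[_]; rewrite eq_sym => ->; rewrite orbT.
  have vx : v \in nbhd (eset G) x by rewrite nbhdC nv -xo set21.
  by rewrite (cardsD1 v (nbhd _ x)) vx cardsU1 leq_add2r leq_b1.
exists (WGraph l0); split.
- by apply: minor_contract => //; [exact: minor_refl | rewrite /= setUC].
- by apply: contract_vset; rewrite // eq_sym.
- apply: dominates_subset sS _; apply: skip_vertex => //.
  + exact: loopless.
  + move=> e Ge ve; rewrite [eset _]eH in_setU1 inE Ge ve orbT; split=> //=.
    rewrite /l; case: eqP => //= eab; rewrite -eab Ge ge_min lexx //.
  + move=> x z; rewrite setUC !vy => xab zab xz.
    have -> : [set x; z] = [set a; b].
      by move: xab zab xz; rewrite !inE => /orP[]/eqP-> /orP[]/eqP->; rewrite ?eqxx // setUC.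
    rewrite [eset _]eH setU11; split=> //=; apply: (le_trans lab).
    rewrite le_eqVlt; apply/orP; left.
    move: xab zab xz; rewrite !inE => /orP[]/eqP-> /orP[]/eqP->; rewrite ?eqxx //.
    by rewrite addrC.
- apply: dominates_subset (subsetT S) _ => x y s _ _ ws.
  apply: walk_expand (ws) => d f df; have := walk_edge ws df.
  rewrite [eset _]eH in_setU1 inE mul1r; have [dfab _|ne] := eqVneq [set d; f] [set a; b].
    rewrite dfab; case/set2_eq: dfab => -[-> ->]; first by exists t.
    have [t' wt' [et' _]] := rev_walk wt; exists t' => //.
    by rewrite (cost_rev _ et').
  move=> /andP[Gdf _]; exists [:: f]; first by rewrite walk_cons Gdf walk_nil.
  by rewrite cost_cons cost_nil addr0 /= /l ne.
- move=> x; have [->|xv] := eqVneq x v.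
    rewrite [nbhd _ v](_ : _ = set0) ?cards0 //.
    apply/setP => y; rewrite inE [eset _]eH !inE; apply/negP => /orP[/eqP vyab|].
      have := set21 v y; rewrite vyab !inE => /orP[]/eqP vE.
        by rewrite vE eqxx in va.
      by rewrite vE eqxx in vb.
    by rewrite eqxx andbF.
  have [xa|xa] := eqVneq x a; first by apply: (degree x b xv); rewrite xa.
  have [xb|xb] := eqVneq x b; first by apply: (degree x a xv); rewrite xb setUC.
  apply/subset_leq_card/subsetP => y; rewrite inE [eset _]eH !inE => /orP[/eqP xyab|/andP[]//].
  by have := set21 x y; rewrite xyab !inE (negPf xa) (negPf xb).
Qed.

(** As removals never raise a degree, every vertex left outside [S] had more than two neighbours
    from the outset. *)
Lemma suppress_vertices (R : realType) (V : finType) (S : {set V}) (G : wgraph R V) :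
  exists H : wgraph R V, [/\ minor S G H,
    dominates 1 S (eset G) (len G) (eset H) (len H),
    dominates 1 S (eset H) (len H) (eset G) (len G) &
    (#|vset H :\: S| <= #|[set x | 2 < #|nbhd (eset G) x|]|)%N].
Proof.
have [n] := ubnP #|vset G|; elim: n G => // n IH G leGn.
have [sub|] := boolP (vset G :\: S \subset [set x | 2 < #|nbhd (eset G) x|]%N).
  exists G; split; [exact: minor_refl|exact: dominates_refl..|].
  exact: subset_leq_card.
case/subsetPn=> v /setDP[Gv vS]; rewrite inE -leqNgt => dv.
have [H [mH vH dGH dHG deg]] := remove_vertex Gv vS dv.
have [|K [mK dHK dKH cK]] := IH H.
  by rewrite vH; rewrite (cardsD1 v) Gv in leGn.
exists K; split.
- exact: minor_trans mH mK.
- by rewrite -[1]mulr1; apply: dominates_trans dHK.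
- by rewrite -[1]mulr1; apply: dominates_trans dHG.
apply: leq_trans cK _; apply/subset_leq_card/subsetP => x; rewrite !inE => xH.
exact: leq_trans xH (deg x).
Qed.

(** * Tree decompositions and the cutting into pieces *)

(** A tree decomposition without its tree: the head is a leaf bag of what remains, and [c] is the
    bag it is attached to. *)
Fixpoint running_intersection (V : finType) (L : seq {set V}) : Prop :=
  if L is b :: L' then
    (L' = [::] \/ exists2 c, c \in L' & forall d, d \in L' -> b :&: d \subset c)
    /\ running_intersection L'
  else True.

Lemma adjC (V : finType) (G : graph V) : symmetric (adj G).
Proof. by move=> x y; rewrite /adj setUC. Qed.

Lemma adj_vset (V : finType) (G : graph V) x y : adj G x y -> x \in vset G /\ y \in vset G.
Proof. by move=> /esetP/andP[]; rewrite subUset !sub1set => /andP[]. Qed.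

(** A path that avoids [i] between two distinct neighbours of [i] would close to a cycle through
    [i]. *)
Lemma acyclic_neighbours (I : finType) (F : graph I) i x y :
  acyclic F -> adj F i x -> adj F y i ->
  connect [rel a b | [&& adj F a b, a != i & b != i]] x y -> x = y.
Proof.
move=> acy ix yi /connectP[p0 /shortenP[p ep up _] yE]; have [//|xy] := eqVneq x y.
case: (acy [:: i, x & p]); first by case: p yE xy {ep up} => // ->; rewrite eqxx.
have ni z : z \in x :: p -> z != i.
  have xi : x != i.
    by case: p ep yE xy {up} => [_ ->|a p /= /andP[/and3P[]]//]; rewrite eqxx.
  rewrite inE => /predU1P[->//|]; elim: p x ep {ix up yE xy xi} => //= a p IH x.
  by move=> /andP[/and3P[_ _ ai] pp]; rewrite inE => /predU1P[->|] //; exact: IH pp.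
apply/andP; split; last first.
  by rewrite cons_uniq up andbT; apply/negP => /ni; rewrite eqxx.
rewrite /= ix rcons_path -yE yi andbT; apply: sub_path ep.
by move=> a b /= /and3P[].
Qed.

(** A connected part of the tree grows by one node [i] at a time, adjacent to an old node [k]. A
    vertex shared by [B i] and an old bag fills the tree path between them, whose first step can
    only lead to [k]. *)
Lemma tree_decomposition_running (V I : finType) (G : graph V) (F : graph I)
    (B : I -> {set V}) : tree_decomposition G F B ->
  exists L, [/\ running_intersection L, L != [::] &
    forall b, (b \in L) = [exists i in vset F, b == B i]].
Proof.
move=> td; have [[[r Fr] conF] acy] := td_tree td.
suff grow n : (0 < n <= #|vset F|)%N -> exists s, [/\ size s = n, uniq s,
    {subset s <= vset F}, running_intersection (map B s) &
    forall i j, i \in s -> j \in s ->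
      connect [rel a b | [&& adj F a b, a \in s & b \in s]] i j].
  have [|s [ss us sF run _]] := grow #|vset F|.
    by rewrite leqnn andbT; apply/card_gt0P; exists r.
  have eqs : s =i vset F.
    have sF' : {subset s <= enum (vset F)} by move=> a /sF; rewrite mem_enum.
    have [|_ eqs a] := uniq_min_size us sF'; first by rewrite -cardE ss.
    by rewrite eqs mem_enum.
  exists (map B s); split=> //.
    by rewrite -size_eq0 size_map ss -lt0n; apply/card_gt0P; exists r.
  move=> b; apply/mapP/exists_inP => [[i]|[i Fi /eqP->]].
    by rewrite eqs => Fi ->; exists i.
  by exists i; rewrite ?eqs.
elim: n => [//|[_ _|n IH]] .
  exists [:: r]; split=> //=; [by move=> x; rewrite inE => /eqP-> | by split; [left|]|].
  by move=> i j; rewrite !inE => /eqP-> /eqP->; exact: connect0.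
move=> /andP[_ leF]; have [s [ss us sF run cons]] := IH (ltnW leF).
have [k [i [ks nis ki]]] : exists k i, [/\ k \in s, i \notin s & adj F k i].
  have [y yF ys] : exists2 y, y \in vset F & y \notin s.
    apply/subsetPn; apply: contraL leF => /subset_leq_card.
    by move/leq_trans/(_ (card_size _)); rewrite ss -leqNgt.
  case: s ss {us cons run IH} sF ys => // k s _ sF ys.
  have /connectP[p pp yE] := conF k y (sF k (mem_head _ _)) yF.
  move: (k :: s) ys (mem_head k s) => s' ys; elim: p k pp yE {sF} => [|a p IHp] k /=.
    by move=> _ <- ys'; rewrite ys' in ys.
  move=> /andP[ka pa] yE ks; have [as_|as_] := boolP (a \in s').
    exact: IHp pa yE as_.
  by exists k, a.
have [Fk Fi] := adj_vset ki.
exists (i :: s); split; rewrite /= ?ss ?nis //.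
- by move=> a; rewrite inE => /predU1P[->//|/sF].
- split=> //; right; exists (B k); first exact: map_f.
  move=> d /mapP[j js ->]; apply/subsetP => v /setIP[vi vj].
  have [//|vk] := boolP (v \in B k).
  have Gv : v \in vset G by rewrite -(td_vset td); apply/bigcupP; exists i.
  have [_ /(_ i j)] := td_conn td Gv; rewrite !inE Fi vi sF //= vj.
  move=> /(_ isT isT)/connectP[p0 /shortenP[p pp up _] jE].
  case: p => [|z p] in pp up jE; first by rewrite jE in js; rewrite js in nis.
  have ind a b : adj (induced F [set i | v \in B i]) a b ->
      [/\ adj F a b, v \in B a & v \in B b].
    by rewrite /adj !inE subUset !sub1set !inE => /and3P[].
  move: pp => /= /andP[/ind[iz _ vz] pp].
  (* Both are neighbours of [i], and they are linked without [i]: [z] to [j] along the rest of the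
     path, [j] to [k] inside [s]. *)
  have zk : z = k.
    apply: (acyclic_neighbours acy iz ki); apply: (@connect_trans _ _ j).
      apply/connectP; exists p => //.
      move: up => /= /andP[]; rewrite inE negb_or => /andP[iz' ip] _.
      elim: p z pp iz' ip {jE iz vz} => //= a p IHp z /andP[/ind[za _ _] pp] iz'.
      rewrite inE negb_or => /andP[ia ip].
      by rewrite za eq_sym iz' eq_sym ia IHp.
    apply: connect_sub (cons j k js ks) => a b /= /and3P[ab as_ bs].
    apply: connect1; rewrite /= ab !(contraNneq _ nis) //; by move=> <-.
  by rewrite -zk vz in vk.
have sub a b : a \in s -> b \in s ->
    connect [rel a b | [&& adj F a b, a \in i :: s & b \in i :: s]] a b.
  move=> as_ bs; apply: connect_sub (cons a b as_ bs) => c d /= /and3P[cd cs ds].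
  by apply: connect1; rewrite /= cd !inE cs ds !orbT.
have symc : connect_sym [rel a b | [&& adj F a b, a \in i :: s & b \in i :: s]].
  by apply: sym_connect_sym => a b /=; rewrite adjC [_ && (_ \in _)]andbC.
have fromi b : b \in s -> connect [rel a b | [&& adj F a b, a \in i :: s & b \in i :: s]] i b.
  move=> bs; apply: connect_trans (sub k b ks bs); apply: connect1.
  by rewrite /= adjC ki !inE eqxx ks orbT.
move=> a b; rewrite [a \in _]inE [b \in _]inE => /predU1P[->|as_] /predU1P[->|bs].
- exact: connect0.
- exact: fromi.
- by rewrite symc fromi.
- exact: sub.
Qed.

(* [A X] hangs off the bag [X]. The first bag of the list is absorbed, with what
   hangs off it, into what hangs off the bag [c] given by the running intersection
   property; once [2 * w] vertices of [T] hang off [c], a piece is cut there and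
   [c] joins the terminals, so that their number drops by at least [w]. *)
Lemma cut_into_pieces (V : finType) (w : nat) (E : {set {set V}})
    (L : seq {set V}) (A : {set V} -> {set V}) (T : {set V}) :
  running_intersection L -> L != [::] ->
  (forall X, X \in L -> #|X| <= w /\ #|A X :&: T| < 2 * w)%N ->
  (forall X Y v, X \in L -> Y \in L -> v \in A X -> v \notin Y) ->
  (forall X Y v, X \in L -> Y \in L -> v \in A X -> v \in A Y -> X = Y) ->
  let U := \bigcup_(X in L) (X :|: A X) in
  (forall e, e \in E -> e \subset U -> exists2 X, X \in L & e \subset X :|: A X) ->
  T \subset U ->
  exists (Ws : seq {set V}) (S : {set V}), [/\
    T \subset S /\ S \subset \bigcup_(W in Ws) W,
    forall W, W \in Ws -> W \subset U /\ (#|W :&: S| <= 6 * w)%N,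
    forall e, e \in E -> e \subset U -> exists2 W, W \in Ws & e \subset W,
    forall v, v \notin S -> (count [pred W : {set V} | v \in W] Ws <= 1)%N &
    (size Ws * w <= #|T| + w)%N].
Proof.
elim: L A T => // b L IH A T /= [adh run] _ small dis disA.
set U := \bigcup_(X in b :: L) _ => EU TU.
have memU v : reflect (exists2 X, X \in b :: L & v \in X :|: A X) (v \in U).
  by apply: bigcupP.
have [L0|L0] := eqVneq L [::].
  have UE : U = b :|: A b.
    apply/setP => v; apply/memU/idP => [[X]|vb]; last by exists b; rewrite // mem_head.
    by rewrite L0 inE => /eqP->.
  (* The last bag and what hangs off it form a final piece with fewer than [3 * w] vertices of [T].
     It accounts for the summand [w] in the count of pieces. *)
  exists [:: U], T; split; last by rewrite mul1n leq_addl.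
  - split=> //; rewrite (bigD1 U) ?mem_head //; exact: subset_trans TU (subsetUl _ _).
  - move=> W; rewrite inE => /eqP->; split=> //.
    rewrite UE setIUl; apply: leq_trans (leq_card_setU _ _) _.
    have [sb sA] := small b (mem_head _ _).
    have sbT : (#|b :&: T| <= w)%N by rewrite (leq_trans (subset_leq_card (subsetIl _ _))).
    move: sA sbT; clear; lia.
  - by move=> e _ eU; exists U; rewrite ?mem_head.
  - by move=> v _; rewrite /= addn0 leq_b1.
have sup X : X \in L -> X \in b :: L by rewrite inE orbC => ->.
(* [A] is indexed by bags and not by positions, so a bag that occurs again is simply skipped. *)
have [bL|bL] := boolP (b \in L).
  have sub X : X \in b :: L -> X \in L by rewrite inE => /predU1P[->|].
  have UE : \bigcup_(X in L) (X :|: A X) = U.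
    by apply: eq_bigl => X; apply/idP/idP; [exact: sup | exact: sub].
  have := IH A T run L0; rewrite /= UE; apply=> //.
  - by move=> X /sup; exact: small.
  - by move=> X Y v /sup XL /sup; exact: dis.
  - by move=> X Y v /sup XL /sup; exact: disA.
  - by move=> e eE /EU[//|X /sub]; exists X.
case: adh => [/eqP|[c cL adh]]; first by rewrite (negPf L0).
have cbL := sup c cL; have bbL := mem_head b L.
(* What hangs off [c] once [b] is absorbed. By running intersection no remaining bag meets
   [b :\: c]. *)
pose A1 := A c :|: (A b :|: b :\: c).
have A1P v X : v \in A1 -> X \in L -> v \notin X.
  move=> + XL; have XbL := sup X XL; rewrite !inE => /or3P[vc|vb|/andP[vc vb]].
  - exact: dis cbL XbL vc.
  - exact: dis bbL XbL vb.
  - by apply: contraNN vc => vX; apply: (subsetP (adh X XL)); rewrite inE vb.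
have A1A v X : v \in A1 -> X \in L -> v \in A X -> X = c.
  move=> + XL vX; have XbL := sup X XL; rewrite !inE => /or3P[vc|vb|/andP[_ vb]].
  - exact: disA vX vc.
  - by rewrite (disA _ _ _ XbL bbL vX vb) (negPf bL) in XL.
  - by have := dis _ _ _ XbL bbL vX; rewrite vb.
have [sc sAc] := small c cbL; have [sb sAb] := small b bbL.
(* Fewer than [2 * w] from each of [A c] and [A b], at most [w] from [b]; adding [c] itself gives
   the bound [6 * w] for a piece. *)
have cA1 : (#|A1 :&: T| < 5 * w)%N.
  have sbc : (#|(b :\: c) :&: T| <= w)%N.
    apply: leq_trans sb; apply/subset_leq_card/subsetP => v.
    by rewrite !inE => /andP[/andP[]].
  rewrite !setIUl; have := leq_of_leqif (leq_card_setU (A c :&: T) (A b :&: T :|: (b :\: c) :&: T)).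
  have := leq_of_leqif (leq_card_setU (A b :&: T) ((b :\: c) :&: T)).
  move: sAc sAb sbc; clear; lia.
have EL e : e \in E -> e \subset U -> e \subset c :|: A1 \/
    exists2 X, X \in L /\ X != c & e \subset X :|: A X.
  move=> eE /EU[//|X]; have [->|Xc] := eqVneq X c.
    move=> _ sub; left; apply: subset_trans sub _.
    by rewrite setUS // subsetUl.
  rewrite inE => /predU1P[->|XL] sub; [left|by right; exists X].
  apply: subset_trans sub _; apply/subsetP => v; rewrite !inE.
  by case: (v \in c) (v \in A b) (v \in b) => [] [] []; rewrite ?orbT.
have UE : U = (\bigcup_(X in L) (X :|: A X)) :|: A1.
  apply/setP => v; apply/memU/setUP => [[X]|].
    rewrite inE => /predU1P[-> vb|XL vX]; last by left; apply/bigcupP; exists X.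
    have [vc|vc] := boolP (v \in c).
      by left; apply/bigcupP; exists c; rewrite // inE vc.
    by right; move: vb; rewrite !inE vc /= => /orP[]->; rewrite !orbT.
  case=> [/bigcupP[X XL vX]|]; first by exists X; rewrite ?sup.
  rewrite !inE => /or3P[vA|vA|/andP[_ vb]].
  - by exists c; rewrite // inE vA orbT.
  - by exists b; rewrite // inE vA orbT.
  - by exists b; rewrite // inE vb.
have [few|many] := ltnP #|A1 :&: T| (2 * w)%N.
  pose A' X := if X == c then A1 else A X.
  have UE' : \bigcup_(X in L) (X :|: A' X) = U.
    rewrite UE; apply/setP => v; apply/bigcupP/setUP => [[X XL]|].
      rewrite /A' inE => /orP[vX|]; first by left; apply/bigcupP; exists X; rewrite // inE vX.
      case: eqP => [_ ->|_ vX]; first by right.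
      by left; apply/bigcupP; exists X; rewrite // inE vX orbT.
    case=> [/bigcupP[X XL vX]|vA1]; last by exists c; rewrite // inE /A' eqxx vA1 orbT.
    exists X => //; rewrite /A' inE; case: eqP vX => [->|_]; rewrite !inE //.
    by case/orP=> -> //; rewrite orbT.
  have := IH A' T run L0; rewrite /= UE'; apply=> //.
  - by move=> X XL; have [? ?] := small X (sup X XL); rewrite /A'; case: ifP.
  - move=> X Y v XL YL; rewrite /A'; case: eqP => [_ /A1P|_]; first exact.
    by apply: dis; rewrite ?sup.
  - move=> X Y v XL YL; rewrite /A'; case: eqP => [->|_]; case: eqP => [->|_] //.
    + by move=> vA1 /(A1A _ _ vA1 YL).
    + by move=> vX /A1A vA1; apply: vA1 vX.
    + by apply: disA; rewrite ?sup.
  - move=> e eE /(EL e eE)[ec|[X [XL Xc] eX]].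
      by exists c => //; rewrite /A' eqxx.
    by exists X => //; rewrite /A' (negPf Xc).
(* The piece [c :|: A1] is cut off. It shares only [c] with the rest, so [c] joins the terminals
   there. *)
pose A' X := if X == c then set0 else A X.
pose U' := \bigcup_(X in L) (X :|: A' X).
have U'E : U' = U :\: A1.
  apply/setP => v; rewrite in_setD UE [v \in _ :|: A1]in_setU; apply/bigcupP/andP => [[X XL]|[vA1]].
    rewrite /A' in_setU => vX.
    have vA1 : v \notin A1.
      apply/negP => vA1; case/orP: vX; first by apply/negP; apply: A1P vA1 XL.
      case: eqP => [_|Xc vX]; first by rewrite inE.
      by case: Xc; exact: A1A vA1 XL vX.
    split=> //; apply/orP; left; apply/bigcupP; exists X => //.
    by move: vX; rewrite inE; case: ifP => // _; rewrite inE orbF => ->.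
  rewrite (negPf vA1) orbF => /bigcupP[X XL vX]; exists X => //.
  move: vX; rewrite /A' !inE => /orP[->//|vX]; case: eqP => [Xc|_]; last by rewrite vX orbT.
  by move: vA1; rewrite inE -Xc vX.
pose T' := (T :\: A1) :|: c.
have cT' : (#|T'| + w <= #|T|)%N.
  have := leq_of_leqif (leq_card_setU (T :\: A1) c); rewrite -/T'.
  move: many; rewrite setIC -(cardsID A1 T); move: sc; clear; lia.
have cU' : c \subset U' by apply/subsetP => v vc; apply/bigcupP; exists c; rewrite // inE vc.
have [] := IH A' T' run L0; rewrite /= -/U'.
- move=> X XL; have [sX AX] := small X (sup X XL); split=> //.
  rewrite /A'; case: eqP => [_|_]; last first.
    apply: leq_ltn_trans AX; apply/subset_leq_card/subsetP => v.
    rewrite !inE => /andP[vX /orP[/andP[_ ->]|vc]]; first by rewrite vX.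
    by have := dis _ _ _ (sup X XL) cbL vX; rewrite vc.
  by rewrite set0I cards0; move: sAc; clear; lia.
- move=> X Y v XL YL; rewrite /A'; case: eqP => _; first by rewrite inE.
  by apply: dis; rewrite sup.
- move=> X Y v XL YL; rewrite /A'; case: eqP => _; case: eqP => _; rewrite ?inE //.
  by apply: disA; rewrite sup.
- move=> e eE; rewrite U'E subsetD => /andP[eU eA1]; have eA1' v : v \in e -> v \notin A1.
    by move=> ve; rewrite (disjointFr eA1).
  case: (EL e eE eU) => [ec|[X [XL Xc] eX]].
    exists c => //; rewrite /A' eqxx setU0; apply/subsetP => v ve.
    by move: (subsetP ec v ve); rewrite inE (negPf (eA1' v ve)) orbF.
  by exists X => //; rewrite /A' (negPf Xc).
- by rewrite subUset cU' U'E setSD.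
move=> Ws [S [[T'S SW] WU EW cW sW]].
have SU' : S \subset U'.
  by apply: subset_trans SW _; apply/bigcupsP => W /WU[].
have A1S v : v \in A1 -> v \notin S.
  by move=> vA1; apply: contraL vA1 => /(subsetP SU'); rewrite U'E => /setDP[].
have cS : c \subset S by apply: subset_trans T'S; exact: subsetUr.
have U'A1 v : v \in U' -> v \notin A1 by rewrite U'E => /setDP[].
(* The terminals in [A1] were dropped from [T'] and return to [S] here. The other pieces avoid [A1],
   so their traces on [S] do not change. *)
exists ((c :|: A1) :: Ws), (S :|: (T :&: A1)); split.
- split.
    apply/subsetP => v vT; rewrite inE [v \in T :&: _]inE vT /=.
    have [_|vA1] := boolP (v \in A1); first by rewrite orbT.
    by rewrite orbF; apply: (subsetP T'S); rewrite in_setU in_setD vA1 vT.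
  rewrite subUset; apply/andP; split; apply/subsetP => v.
    move=> /(subsetP SW)/bigcupP[W WWs vW]; apply/bigcupP; exists W => //.
    by rewrite inE WWs orbT.
  move=> /setIP[_ vA1]; apply/bigcupP; exists (c :|: A1); first exact: mem_head.
  by rewrite inE vA1 orbT.
- move=> W; rewrite inE => /predU1P[->|WWs].
    split.
      rewrite UE subUset subsetUr andbT.
      apply: subset_trans (subsetUl _ _); apply/subsetP => v vc; apply/bigcupP.
      by exists c; rewrite // inE vc.
    apply: (@leq_trans #|c :|: A1 :&: T|).
      apply/subset_leq_card/subsetP => v /setIP[/setUP[vc _|vA1]].
        by rewrite in_setU vc.
      rewrite in_setU (negPf (A1S v vA1)) in_setI /= => /andP[vT _].
      by rewrite in_setU [v \in A1 :&: T]in_setI vA1 vT orbT.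
    apply: leq_trans (leq_card_setU _ _) _; move: sc cA1; clear; lia.
  have [WU' cWS] := WU W WWs; split.
    by apply: subset_trans WU' _; rewrite U'E subsetDl.
  rewrite (_ : W :&: _ = W :&: S) //; apply/setP => v; rewrite !in_setI in_setU.
  have [vW|//] := boolP (v \in W).
  by rewrite in_setI (negPf (U'A1 _ (subsetP WU' v vW))) andbF orbF.
- move=> e eE eU; case: (EL e eE eU) => [ec|[X [XL Xc] eX]].
    by exists (c :|: A1); rewrite ?mem_head.
  have [|W WWs eW] := EW e eE; last by exists W; rewrite // inE WWs orbT.
  rewrite U'E subsetD eU; apply/pred0P => v /=; apply/andP => -[ve vA1].
  have /setUP[vX|vX] := subsetP eX v ve; first by have := A1P _ _ vA1 XL; rewrite vX.
  by have := A1A _ _ vA1 XL vX; apply/eqP.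
- move=> v; rewrite inE negb_or => /andP[vS vTA] /=.
  have [vcA|vcA] := boolP (v \in c :|: A1); last by rewrite add0n cW.
  have vA1 : v \in A1.
    by move: vcA; rewrite inE => /orP[/(subsetP cS)|//]; rewrite (negPf vS).
  rewrite -[leqRHS]addn0 leq_add2l leqn0 eqn0Ngt -has_count; apply/hasPn.
  move=> W WWs; apply/negP => vW; have [WU' _] := WU W WWs.
  by have := U'A1 v (subsetP WU' v vW); rewrite vA1.
- by rewrite /= mulSn; move: sW cT'; clear; lia.
Qed.

(** * From walks to distances, and gluing the pieces *)

(** Dividing by [a] leaves one inequality for each path of [G], so infinite distances need no
    separate case. The dominating walk is shortened because [dist] ranges over simple paths. *)
Lemma dominates_dist (R : realType) (V : finType) (T : {set V}) (a : R)
    (G H : wgraph R V) (x y : V) : 0 < a ->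
  dominates a T (eset G) (len G) (eset H) (len H) -> x \in T -> y \in T ->
  (dist H x y <= a%:E * dist G x y)%E.
Proof.
move=> a0 dom xT yT; rewrite -lee_pdivrMl //; apply: ereal.le_ereal_inf_tmp => _ [s [ps us ls] <-].
rewrite lee_pdivrMl // -EFinM.
have ws : walk (eset G) x y s by rewrite walk_path ls eqxx.
have [t wt ct] := dom x y s xT yT ws.
have [u wu [uu sub]] := simple_walk wt.
apply: (@le_trans _ _ (cost (len H) x u)%:E).
  apply: ereal.ereal_inf_lbound; exists u => //.
  by move: wu; rewrite walk_path => /andP[/eqP lu pu].
rewrite lee_fin; apply: le_trans ct; apply: le_cost => // e et.
exact/ltW/len_gt0/(walk_edge wt).
Qed.

Section Pieces.
Variables (R : realFieldType) (V : finType) (E : {set {set V}}).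
Variables (l : {set V} -> R) (Ws : seq {set V}) (S : {set V}).
Hypothesis overlap : forall v, v \notin S ->
  (count [pred W : {set V} | v \in W] Ws <= 1)%N.
Hypothesis cover : forall e, e \in E -> exists2 W, W \in Ws & e \subset W.

Definition within (W : {set V}) : {set {set V}} := [set e in E | e \subset W].

Lemma unique_piece v W W' : v \notin S -> W \in Ws -> W' \in Ws ->
  v \in W -> v \in W' -> W = W'.
Proof.
move=> /overlap + WWs WWs' vW vW'; rewrite -size_filter; have [//|ne] := eqVneq W W'.
have : {subset [:: W; W'] <= filter [pred W : {set V} | v \in W] Ws}.
  by move=> X; rewrite !inE mem_filter => /orP[]/eqP->; rewrite /= ?vW ?vW'.
move/uniq_leq_size; rewrite /= inE ne => /(_ isT) le2 /(leq_trans le2).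
by [].
Qed.

(** Consecutive edges share a vertex outside [S], which lies in one piece only; hence they lie in
    the same piece. *)
Lemma walk_in_piece x z s : walk E x z (rcons s z) -> {in s, forall v, v \notin S} ->
  exists2 W, W \in Ws & walk (within W) x z (rcons s z).
Proof.
elim: s x => [|a s IH] x /=; rewrite walk_cons => /andP[xa ws] nS.
  by have [W WWs eW] := cover xa; exists W; rewrite // walk_cons inE xa eW walk_nil.
have [|W WWs wW] := IH a ws; first by move=> v vs; rewrite nS // inE vs orbT.
exists W; rewrite // walk_cons wW andbT inE xa.
have [W' WWs' eW'] := cover xa; rewrite (_ : W = W') //.
apply: (@unique_piece a) => //; first by rewrite nS ?mem_head.
  case: (s) wW => [|b s'] /=; rewrite walk_cons inE => /andP[/andP[_ /subsetP sub] _];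
    by apply: sub; rewrite set21.
by apply: (subsetP eW'); rewrite set22.
Qed.

(** The walk is cut at its next visit to [S]. Up to there it stays in one piece, whose domination
    applies, and the remainder is shorter. *)
Lemma dominates_pieces (a : R) (F : {set V} -> {set {set V}}) :
  (forall W, W \in Ws -> dominates a (W :&: S) (within W) l (F W) l) ->
  dominates a S E l (\bigcup_(W in Ws) F W) l.
Proof.
move=> dom x y s; have [n] := ubnP (size s); elim: n s x => // n IH s x sn xS yS ws.
have [sS|nS] := boolP (has [in S] s); last first.
  case: s sn ws nS => [_|z s _] ws; last first.
    move=> /hasPn/(_ y); have yl : last z s = y := walk_last ws.
    by rewrite -{1}yl mem_last /= yS => /(_ isT).
  move=> _; exists [::]; first by rewrite -(walk_last ws) walk_nil.
  by rewrite cost_nil mulr0.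
case/split_find: sS sn ws => z s1 s2 /= zS nS sn ws.
have [ws1 ws2] := walk_catP ws; rewrite last_rcons in ws1 ws2.
have [W WWs w1] : exists2 W, W \in Ws & walk (within W) x z (rcons s1 z).
  by apply: walk_in_piece ws1 _ => v vs1; have := hasPn nS v vs1.
have sub e : e \in edges x (rcons s1 z) -> e \subset W.
  by move/(walk_edge w1); rewrite inE => /andP[].
have xW : x \in W.
  by case: (s1) sub => [|b s'] sub; apply: (subsetP (sub _ (mem_head _ _))); rewrite set21.
have zW : z \in W.
  apply: (subsetP (sub [set last x s1; z] _)); last by rewrite set22.
  by rewrite -cats1 edges_cat mem_cat mem_head orbT.
have [||t1 wt1 ct1] := dom W WWs x z _ _ _ w1; rewrite ?inE ?xW ?zW //.
have [|t2 wt2 ct2] := IH s2 z _ zS yS ws2.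
  by move: sn; rewrite size_cat size_rcons; clear; lia.
exists (t1 ++ t2).
  apply: walk_cat wt2; apply: walk_subset wt1; exact: bigcup_sup.
by rewrite !cost_cat last_rcons (walk_last wt1) mulrDr lerD.
Qed.

(** Outside [S] all edges at a vertex belong to one piece, so its neighbours in the union are its
    neighbours in a single [F W]. *)
Lemma branching_pieces (F : {set V} -> {set {set V}}) :
  (forall W, W \in Ws -> F W \subset within W) ->
  [set x | (2 < #|nbhd (\bigcup_(W in Ws) F W) x|)%N] \subset
    S :|: \bigcup_(W in Ws) [set x | (2 < #|nbhd (F W) x|)%N].
Proof.
move=> FE; apply/subsetP => x; rewrite inE in_setU => x3.
have [//|xS /=] := boolP (x \in S).
have inW y W : W \in Ws -> [set x; y] \in F W -> x \in W.
  move=> WWs /(subsetP (FE W WWs)); rewrite inE => /andP[_ /subsetP]; apply.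
  by rewrite set21.
have [y] : exists y, y \in nbhd (\bigcup_(W in Ws) F W) x.
  by apply/card_gt0P; apply: leq_trans x3.
rewrite inE => /bigcupP[W WWs xyW]; apply/bigcupP; exists W => //.
rewrite inE; apply: (leq_trans x3); apply/subset_leq_card/subsetP => z.
rewrite !inE => /bigcupP[W' WWs' xzW']; rewrite (_ : W = W') //.
by apply: (unique_piece xS) => //; [exact: inW xyW | exact: inW xzW'].
Qed.

End Pieces.

(** * Counting and assembly *)

Lemma leq_card_bigcup (I V : finType) (r : seq I) (F : I -> {set V}) :
  (#|\bigcup_(i in r) F i| <= \sum_(i in r) #|F i|)%N.
Proof.
elim/big_rec2: _ => [|i n A _ le]; first by rewrite cards0.
by apply: leq_trans (leq_of_leqif (leq_card_setU _ _)) _; rewrite leq_add2l.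
Qed.

Lemma sum_seq_le (R : realFieldType) (I : finType) (r : seq I) (F : I -> R) (c : R) :
  0 <= c -> (forall i, i \in r -> F i <= c) -> \sum_(i in r) F i <= (size r)%:R * c.
Proof.
move=> c0 le; apply: (le_trans (ler_sum _ le)).
by rewrite sumr_const -[_ *+ _]mulr_natl ler_wpM2r // ler_nat card_size.
Qed.

Theorem theorem4p6 (R : realType) :
  exists C : R, 0 < C /\
    forall (p q : nat) (V : finType) (G : wgraph R V) (T : {set V}),
      (1 <= p)%N -> (1 <= q)%N ->
      T \subset vset G ->
      (treewidth G <= p)%N -> (p <= #|T|)%N ->
      exists H : wgraph R V,
        is_DAM_size T G (2 * q%:R - 1)
          (C * (p%:R `^ (1 + 2 / q%:R) * #|T|%:R)) H.
Proof.
(* [S] has at most [18 * k] vertices and is counted twice, among the branching vertices and among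
   the non-terminals: hence 36. A piece has at most [2 * (12 * a * (12 * p)) ^ 2] branching
   vertices, with [a ^ q = p], and there are at most [3 * k / p] pieces: hence [2 * 144 ^ 2 * 3]. *)
exists (36 + 6 * 144 ^+ 2); split; first by rewrite addr_gt0 ?mulr_gt0 ?exprn_gt0.
move=> p q V G T p1 q1 TG twG pT.
pose w := p.+1.
have [I [Tr [B [td wd]]]] : exists (I : finType) (F : graph I) (B : I -> {set V}),
    tree_decomposition G F B /\ forall i, i \in vset F -> (#|B i| <= w)%N.
  move: twG; rewrite /treewidth.
  case: ex_minnP => m /boolp.asboolP[I [F [B [td mE]]]] _ mp.
  exists I, F, B; split=> // i Fi; apply: (@leq_trans (\max_(i in vset F) #|B i|)).
    exact: leq_bigmax_cond.
  by move: mE mp; rewrite /td_width /w; clear; lia.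
have [L [run L0 LB]] := tree_decomposition_running td.
have UE : \bigcup_(X in L) (X :|: set0) = vset G.
  rewrite -(td_vset td); apply/setP => v; apply/bigcupP/bigcupP => [[X]|[i Fi vi]].
    by rewrite LB setU0 => /exists_inP[i Fi /eqP->] vi; exists i.
  by exists (B i); rewrite ?setU0 // LB; apply/exists_inP; exists i.
have [] := @cut_into_pieces V w (eset G) L (fun=> set0) T run L0; rewrite /= ?UE //.
- move=> X; rewrite LB => /exists_inP[i Fi /eqP->]; rewrite wd // set0I cards0.
  by split.
- by move=> X Y v; rewrite inE.
- by move=> X Y v; rewrite inE.
- move=> e eG _; have [i Fi ei] := td_eset td eG; exists (B i); rewrite ?setU0 //.
  by rewrite LB; apply/exists_inP; exists i.
move=> Ws [S [[TS SW] WU EW overlap szWs]].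
have cover e : e \in eset G -> exists2 W, W \in Ws & e \subset W.
  by move=> eG; apply: EW => //; have /andP[] := esetP eG.
(* The factor 12 ensures [r ^ q >= 12 * p], and [12 * p] bounds the [6 * (p + 1)] vertices of [S] in
   a piece, as the spanner requires. *)
pose a : R := p%:R `^ (q%:R^-1); pose r := 12 * a.
have a0 : 0 <= a by exact: powR_ge0.
have q0R : q%:R != 0 :> R by rewrite pnatr_eq0 -lt0n.
have aq : a ^+ q = p%:R.
  by rewrite -powR_mulrn // -powRrM mulVf // powRr1.
have aP : p%:R `^ (1 + 2 / q%:R) = p%:R * a ^+ 2.
  rewrite powRD; last by rewrite pnatr_eq0 -lt0n p1 implybT.
  by rewrite powRr1 // [2 / _]mulrC powRrM -/a powR_mulrn.
have r0 : 0 <= r by rewrite mulr_ge0.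
have piece W : W \in Ws -> exists F : {set {set V}},
    [/\ F \subset within (eset G) W,
        dominates (2 * q%:R - 1) (W :&: S) (within (eset G) W) (len G) F (len G) &
        #|[set x | (2 < #|nbhd F x|)%N]|%:R <= 2 * (r * (12 * p%:R)) ^+ 2].
  move=> WWs; have cW : (#|W :&: S| <= 12 * p)%N.
    by have [_ cW] := WU W WWs; move: cW p1; rewrite /w; clear; lia.
  have [||F [sF dF bF]] := @terminal_spanner R V (within (eset G) W) (len G) (W :&: S) q r _ q1 r0.
  - by move=> e; rewrite inE => /andP[/len_gt0].
  - rewrite exprMn aq; apply: (@le_trans _ _ (12 * p%:R)).
      by rewrite -natrM ler_nat.
    by rewrite ler_wpM2r // -[leLHS]expr1 ler_eXn2l // ltr1n.
  exists F; split=> //; apply: (le_trans bF).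
  rewrite ler_pM2l // lerXn2r ?nnegrE ?mulr_ge0 // ler_wpM2l //.
  by rewrite -natrM ler_nat.
have /boolp.choice[F FP] W : exists F : {set {set V}}, W \in Ws ->
    [/\ F \subset within (eset G) W,
        dominates (2 * q%:R - 1) (W :&: S) (within (eset G) W) (len G) F (len G) &
        #|[set x | (2 < #|nbhd F x|)%N]|%:R <= 2 * (r * (12 * p%:R)) ^+ 2].
  by have [/piece[F FP]|_] := boolP (W \in Ws); [exists F | exists set0].
pose FF := \bigcup_(W in Ws) F W.
have sFF : FF \subset eset G.
  apply/bigcupsP => W /FP[+ _ _] => /subset_trans; apply.
  by apply/subsetP => e; rewrite inE => /andP[].
(* Minors are formed with all of [S] as terminals, so that [S] survives; they are then minors for
   the smaller set [T]. *)
have [G' [mG' vG' eG']] := spanning_subgraph_minor S sFF.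
have G'0 e : e \in eset G' -> 0 < len G e.
  by rewrite eG' => /(subsetP sFF)/len_gt0.
have [H [mH dGH dHG cH]] := suppress_vertices S (WGraph G'0).
have dom1 : dominates (2 * q%:R - 1) S (eset G) (len G) FF (len G).
  by apply: (dominates_pieces overlap cover) => W /FP[].
have domGH : dominates (2 * q%:R - 1) T (eset G) (len G) (eset H) (len H).
  apply: dominates_subset TS _; rewrite -[2 * _ - 1]mul1r.
  by apply: dominates_trans dGH; rewrite //= eG'.
have domHG : dominates 1 T (eset H) (len H) (eset G) (len G).
  apply: dominates_subset TS _; rewrite -[1]mulr1; apply: dominates_trans dHG _ => //=.
  rewrite eG' => x y s _ _ ws; exists s; last by rewrite mul1r.
  exact: walk_subset ws.
have q2 : 0 < 2 * q%:R - 1 :> R.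
  by rewrite subr_gt0 -natrM ltr1n; move: q1; clear; lia.
exists H; split.
  split; first by apply: minor_subset TS _; exact: minor_trans mG' mH.
  move=> t t' tT t'T; split; last exact: dominates_dist domGH tT t'T.
  by rewrite -[leRHS]mul1e; apply: dominates_dist domHG tT t'T.
set k := #|T| in pT szWs *.
(* From [size Ws * (p + 1) <= k + p + 1]; here [p <= k] makes the right-hand side linear in [k]. *)
have Np : (size Ws * p <= 3 * k)%N.
  by move: szWs pT p1; rewrite /w mulnS; clear; lia.
have cS : (#|S| <= 18 * k)%N.
  apply: (@leq_trans (size Ws * (6 * w))); last first.
    by move: szWs pT p1; rewrite mulnCA /w; clear; lia.
  apply: (@leq_trans #|\bigcup_(W in Ws) (W :&: S)|).
    apply/subset_leq_card/subsetP => v vS; have /bigcupP[W WWs vW] := subsetP SW v vS.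
    by apply/bigcupP; exists W; rewrite // inE vW.
  apply: leq_trans (leq_card_bigcup _ _) _.
  rewrite -(ler_nat R) natr_sum natrM; apply: sum_seq_le => // W /WU[_].
  by rewrite ler_nat.
pose b : R := 2 * (r * (12 * p%:R)) ^+ 2.
have b0 : 0 <= b by rewrite mulr_ge0 ?exprn_ge0 ?mulr_ge0.
have cB : #|[set x | (2 < #|nbhd FF x|)%N]|%:R <= 18 * k%:R + (size Ws)%:R * b.
  apply: (@le_trans _ _ (#|S| + #|\bigcup_(W in Ws) [set x | (2 < #|nbhd (F W) x|)%N]|)%:R).
    rewrite ler_nat; apply: leq_trans (leq_of_leqif (leq_card_setU _ _)).
    apply/subset_leq_card/(branching_pieces (E := eset G) overlap) => W.
    by case/FP.
  rewrite natrD lerD //; first by rewrite -natrM ler_nat.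
  apply: (@le_trans _ _ (\sum_(W in Ws) #|[set x | (2 < #|nbhd (F W) x|)%N]|)%:R).
    by rewrite ler_nat leq_card_bigcup.
  by rewrite natr_sum; apply: sum_seq_le => // W /FP[].
have cHT : #|vset H :\: T|%:R <= 36 * k%:R + (size Ws)%:R * b.
  apply: (@le_trans _ _ (#|vset H :\: S| + #|S|)%:R).
    rewrite ler_nat; apply: leq_trans (leq_of_leqif (leq_card_setU _ _)).
    apply/subset_leq_card/subsetP => v; rewrite !inE => /andP[_ ->].
    by case: (v \in S).
  have : #|vset H :\: S|%:R <= 18 * k%:R + (size Ws)%:R * b.
    by apply: le_trans cB; rewrite ler_nat (leq_trans cH) //= eG'.
  have : #|S|%:R <= 18 * k%:R :> R by rewrite -natrM ler_nat.
  rewrite natrD; lra.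
apply: (le_trans cHT); rewrite aP.
have NpR : (size Ws)%:R * p%:R <= 3 * k%:R :> R by rewrite -!natrM ler_nat.
have p1R : 1 <= p%:R :> R by rewrite ler1n.
have a1 : 1 <= a by rewrite -(@expr_ge1 _ q) // aq.
(* This factor is [p ^ (1 + 2 / q)]; being at least 1, it absorbs the summand [36 * k]. *)
have pa1 : 1 <= p%:R * a ^+ 2 by rewrite mulr_ege1 // exprn_ege1.
have -> : (size Ws)%:R * b =
    2 * 144 ^+ 2 * (p%:R * a ^+ 2 * ((size Ws)%:R * p%:R)) by rewrite /b /r; ring.
have k_le : k%:R <= p%:R * a ^+ 2 * k%:R by rewrite ler_peMl.
have : p%:R * a ^+ 2 * ((size Ws)%:R * p%:R) <= p%:R * a ^+ 2 * (3 * k%:R).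
  by rewrite ler_wpM2l // (le_trans _ pa1).
move: (p%:R * a ^+ 2) ((size Ws)%:R * p%:R) k_le => x y k_le; lra.
Qed.
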